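(* Let $k\ge 2$ be an integer, $q$ a prime power, and $h\in\mathbb{F}_q[x]$ a non-constant polynomial. Let $\ell$ be the largest positive integer such that $h=Cf^{\ell}$ for some $C\in\mathbb{F}_q^*$ and $f\in\mathbb{F}_q[x]$ (and fix such $C$ and $f$). Let $n=\gcd(\ell,q-1)$ and let $H$ be the subgroup of $\mathbb{F}_q^*$ of index $n$. Let $g$ be a generator of $\mathbb{F}_q^*$ and let $s$ be the unique integer in $\{0,1,\ldots,n-1\}$ such that $C\in g^sH$. Then \[ F_k(q;h)=\frac{m(k,n;s)}{n}\cdot q+O(\sqrt{q}), \] where the implied constant of the error term depends only on $k$ and the degree of $h$. That is, for all integers $k\ge 2$ and $D\ge 1$ there is a constant $K=K(k,D)$ such that the following holds for every prime power $q$ and every $h\in\mathbb{F}_q[x]$ of degree $D$: if $\ell$ is the largest positive integer such that $h$ is a constant multiple of an $\ell$-th power in $\mathbb{F}_q[x]$, $h=Cf^{\ell}$ with $C\in\mathbb{F}_q^*$ and $f\in\mathbb{F}_q[x]$, $n=\gcd(\ell,q-1)$, $H$ is the subgroup of $\mathbb{F}_q^*$ of index $n$, $g$ is a generator of $\mathbb{F}_q^*$, and $s\in\{0,1,\ldots,n-1\}$ satisfies $C\in g^sH$, then $\left|F_k(q;h)-\frac{m(k,n;s)}{n}q\right|\le K\sqrt q$.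
   Context: $\mathbb{F}_q$ is the finite field with $q$ elements, $\mathbb{F}_q^*$ its multiplicative group, and $\mathbb{Z}_n=\mathbb{Z}/n\mathbb{Z}$. For a positive integer $k$, a prime power $q$ and a non-constant $h\in\mathbb{F}_q[x]$, $F_k(q;h)$ is the maximum of $|A|$ over all subsets $A\subset\mathbb{F}_q^*$ such that for all distinct $a_1,\dots,a_k\in A$ and all $x\in\mathbb{F}_q$, $a_1a_2\cdots a_k\ne h(x)$. For $B\subset\mathbb{Z}_n$, the $k$-fold sumset is $kB=\{b_1+\cdots+b_k: b_i\in B \text{ for } 1\le i\le k\}$ (repetitions allowed). For $s\in\mathbb{Z}_n$, $m(k,n;s)=\max\{|B|: B\subset\mathbb{Z}_n,\ s\notin kB\}$ (the empty set is allowed, with empty sumset). An integer $s$ is viewed as an element of $\mathbb{Z}_n$ via reduction mod $n$. *)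

(* Defs.v *)
From HB Require Import structures.
From mathcomp Require Import all_boot all_order all_algebra all_fingroup.
From mathcomp Require Import reals.

Set Implicit Arguments.
Unset Strict Implicit.
Unset Printing Implicit Defensive.

Import Order.TTheory GRing.Theory Num.Theory.

Local Open Scope ring_scope.

Definition avoids_values (F : finFieldType) (k : nat) (h : {poly F})
    (A : {set {unit F}}) : bool :=
  [forall a : {ffun 'I_k -> {unit F}}, forall x : F,
     (a \in ffun_on (mem A)) && injectiveb a ==>
       (\prod_(i < k) (val (a i) : F) != h.[x])].

(* F_k(q; h), with q = #|F| *)
Definition max_avoiding (F : finFieldType) (k : nat) (h : {poly F}) : nat :=
  \max_(A : {set {unit F}} | avoids_values k h A) #|A|%N.

(* Z/nZ as an additive group, for n > 0; unlike 'Z_n, this is also correct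
   (the trivial group) for n = 1. *)
Notation Zmod n := 'I_n.-1.+1.

Definition ksumset (V : finZmodType) (k : nat) (B : {set V}) : {set V} :=
  [set \sum_(i < k) (b : {ffun 'I_k -> V}) i | b in ffun_on (mem B)].

(* m(k, n; s) *)
Definition max_sumset_missing (k n : nat) (s : Zmod n) : nat :=
  \max_(B : {set Zmod n} | s \notin ksumset k B) #|B|%N.

Definition const_mul_power (F : finFieldType) (h : {poly F}) (l : nat) : Prop :=
  exists (C : {unit F}) (f : {poly F}), h = (val C : F) *: f ^+ l.

Definition largest_power (F : finFieldType) (h : {poly F}) (l : nat) : Prop :=
  [/\ (0 < l)%N, const_mul_power h l
    & forall m : nat, (0 < m)%N -> const_mul_power h m -> (m <= l)%N].

(* Main.v *)
(** If [A] meets the coset [g^i H] in many elements for every [i] in [B] and [s]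
    is in [kB], then [A] contains distinct [a_1, ..., a_k] whose product is a value
    of [h]: fix [a_3, ..., a_k], let [a_1] and [a_2] vary in sets of size about
    [sqrt q], and count the solutions of [a_1 a_2 c = h(x)] with multiplicative
    characters.  The characters trivial on [H] give the main term, and the others
    are controlled by the Weil bound [|sum_x chi(f(x))| <= (deg f + 1) sqrt q].
    So the elements of [A] outside the cosets indexed by a set [B] with [s] not in
    [kB] number only [O(sqrt q)]; conversely a union of cosets indexed by such a
    [B] avoids the values of [h].

    The Weil bound is proved over an algebraic closure [K] of [F].  The generating
    series of the sums of [chi] over the monic polynomials of degree [n] is a
    polynomial divided by [1 - b t], so the sums of [chi o Norm o f] over the fields
    with [q^m] elements are power sums [b^m - sum w^m]; it then suffices to bound
    them by [C sqrt(q)^m] with [C] independent of [m].  This follows from Stepanov's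
    method in Bombieri's form: with [m = t + t'], a polynomial
    [sum_(i,j) w_ij f^(n' i) X^(j q^t')] of small degree is made to vanish on a
    fiber of [Norm o f], raising to the power [q^t] replacing derivatives.  It is
    not zero because [f(X) Y^d - f(Z)] is irreducible enough, [f] not being a power. *)
Require Import Defs.
From HB Require Import structures.
From mathcomp Require Import all_boot all_order all_algebra all_fingroup.
From mathcomp Require Import all_solvable all_field.
From mathcomp Require Import reals zify ring lra.

Set Implicit Arguments.
Unset Strict Implicit.
Unset Printing Implicit Defensive.

Import Order.TTheory GRing.Theory Num.Theory.

Local Open Scope ring_scope.

(** * Powers and binomials over function fields *)


Definition power_free (K : fieldType) (d : nat) (f : {poly K}) :=
  forall (r : nat) (b : {poly K}), (1 < r)%N -> (r %| d)%N -> ~~ (f %= b ^+ r).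

Lemma eqp_exp2r (K : fieldType) (p q : {poly K}) k :
  (0 < k)%N -> (p ^+ k %= q ^+ k) = (p %= q).
Proof. by move=> k0; rewrite /eqp !dvdp_pexp2r. Qed.

(** Dividing [k] and [d] by their gcd gives [f ^+ k' %= w ^+ d'] with coprime exponents and
    [d' > 1]. A Bezout relation [x k' = y d' + 1] then makes [f] itself a [d']-th power up to a
    unit, although [d'] divides [d]. *)
Lemma power_free_expr (K : fieldType) (d k : nat) (f w : {poly K}) :
  power_free d f -> f != 0 -> (0 < k < d)%N -> ~~ (f ^+ k %= w ^+ d).
Proof.
move=> pf f0 /andP[k0 kd]; apply/negP => E.
have d0 : (0 < d)%N by apply: leq_trans kd.
pose a := gcdn k d.
have a0 : (0 < a)%N by rewrite gcdn_gt0 k0.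
pose k' := (k %/ a)%N; pose d' := (d %/ a)%N.
have ka : k = (k' * a)%N by rewrite divnK // dvdn_gcdl.
have da : d = (d' * a)%N by rewrite divnK // dvdn_gcdr.
have k'0 : (0 < k')%N by move: k0; rewrite ka muln_gt0 => /andP[].
have kd' : (k' < d')%N by move: kd; rewrite ka da ltn_pmul2r.
have cop : coprime k' d'.
  by rewrite /coprime -(eqn_pmul2r a0) muln_gcdl -ka -da mul1n.
move: E; rewrite {1}ka {1}da !exprM eqp_exp2r // => E.
case: (egcdnP d' k'0) => x y xy _; rewrite (eqP cop) in xy.
have E2 : f * (f ^+ y) ^+ d' %= (w ^+ x) ^+ d'.
  by rewrite -exprM -exprS -exprM -addn1 -xy mulnC exprM mulnC exprM; apply: eqp_exp.
have d'0 : (0 < d')%N by apply: leq_ltn_trans kd'.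
have /dvdpP[b wb] : f ^+ y %| w ^+ x.
  rewrite -(@dvdp_pexp2r _ _ _ d') // -(eqp_dvdr _ E2).
  exact: dvdp_mull.
move: E2; rewrite wb exprMn eqp_mul2r ?expf_neq0 // => E3.
move: (pf d' b); rewrite E3 => /(_ _ _)/negP; apply => //.
  by apply: leq_ltn_trans kd'.
by rewrite da dvdn_mulr.
Qed.

Lemma companion_exists (R : comNzRingType) (p : {poly R}) n :
  p \is monic -> size p = n.+1 -> exists M : 'M[R]_n, char_poly M = p.
Proof.
move=> pm sp; have := companionmxK pm.
move: (companionmx p); rewrite sp /= => M <-; by exists M.
Qed.

Lemma fraction_repr (R : idomainType) (x : {fraction R}) :
  exists n d : R, d != 0 /\ x * @FracField.tofrac R d = @FracField.tofrac R n.
Proof.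
elim/quotW: x => x; case: x => [[n d] /= d0]; exists n, d; split => //.
apply/eqP; rewrite !piE /equivf /FracField.mulf.
by rewrite !numden_Ratio ?oner_eq0 ?mulr1 ?mulf_neq0 ?oner_eq0 //= mulrC.
Qed.

(* If G is a monic common factor of degree k, its companion matrix M satisfies
   c M^d = f, so that c^k (det M)^d = f^k. *)
Lemma coprime_binomial (K : fieldType) (d : nat) (f : {poly K}) (c : K)
    (P : {poly {fraction {poly K}}}) :
  power_free d f -> f != 0 -> c != 0 -> P != 0 -> (size P <= d)%N ->
  coprimep P (FracField.tofrac c%:P *: 'X^d - (FracField.tofrac f)%:P).
Proof.
set tf := @FracField.tofrac _; set W := _ - _ => pf f0 c0 P0 sP.
have d0 : (0 < d)%N by apply: leq_trans sP; rewrite size_poly_gt0.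
rewrite coprimep_def; case: eqVneq => // sG.
pose G := (lead_coef (gcdp P W))^-1 *: gcdp P W.
have g0 : gcdp P W != 0 by rewrite gcdp_eq0 negb_and P0.
have Gm : G \is monic by rewrite monicE lead_coefZ mulVf // lead_coef_eq0.
have sGE : size G = size (gcdp P W).
  by rewrite size_scale // invr_eq0 lead_coef_eq0.
have [k sk] : exists k, size G = k.+2.
  move: sG; rewrite -sGE; have := monic_neq0 Gm; rewrite -size_poly_gt0.
  by case: (size G) => [|[|k]] // _ _; exists k.
have kd : (k.+1 < d)%N.
  by rewrite -ltnS -sk sGE ltnS (leq_trans _ sP) // dvdp_leq // dvdp_gcdl.
have [M cM] := companion_exists Gm sk.
have GW : G %| W by rewrite dvdpZl ?dvdp_gcdr // invr_eq0 lead_coef_eq0.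
have MW : horner_mx M W = 0.
  by case/dvdpP: GW => V ->; rewrite rmorphM /= -cM Cayley_Hamilton mulr0.
have E : tf c%:P ^+ k.+1 * \det M ^+ d = tf f ^+ k.+1.
  have : tf c%:P *: M ^+ d = (tf f)%:M.
    move: MW; rewrite /W rmorphB /= horner_mx_C linearZ /= rmorphXn /= horner_mx_X.
    by move/eqP; rewrite subr_eq0 => /eqP.
  move/(congr1 determinant); rewrite detZ det_scalar => <-; congr (_ * _).
  by elim: d {kd d0 W MW GW sP pf G Gm sGE sk cM sG g0} => [|d IH];
    rewrite ?expr0 ?det1 // !exprS det_mulmx IH.
have [n [e [e0 He]]] := fraction_repr (\det M).
have : (c ^+ k.+1)%:P * n ^+ d = f ^+ k.+1 * e ^+ d.
  apply/eqP; rewrite -tofrac_eq !rmorphM !rmorphXn /= -/tf; apply/eqP.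
  by rewrite -/tf in He; rewrite -He -E exprMn mulrA.

(* The polynomial ring is integrally closed: [e ^+ d] divides [n ^+ d] up to a constant, so the
   fraction [\det M] is in fact a polynomial [w]. *)
move=> E2; have /dvdpP[w nw] : e %| n.
  rewrite -(@dvdp_pexp2r _ _ _ d) //.
  rewrite -(@dvdpZr _ (c ^+ k.+1)) ?expf_neq0 //.
  by rewrite -mul_polyC E2 dvdp_mull.
move: E2; rewrite nw exprMn mulrA => /(mulIf (expf_neq0 d e0)) E3.
have /negP[] := power_free_expr (k := k.+1) w pf f0 kd.
by apply/eqpf_eq; exists (c ^+ k.+1); rewrite ?expf_neq0 // -E3 mul_polyC.
Qed.

(** * A non-vanishing criterion *)


Lemma size_det_leq (R : comNzRingType) n (A : 'M[{poly R}]_n) (b : 'I_n -> nat) :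
  (forall i j, (size (A i j) <= (b i).+1)%N) ->
  (size (\det A) <= (\sum_i b i).+1)%N.
Proof.
move=> Ab; apply: leq_trans (size_sum _ _ _) _; apply/bigmax_leqP => s _.
rewrite -signr_odd; case: (odd _); rewrite ?mulN1r ?size_polyN ?mul1r;
  (apply: leq_trans (size_prod_leq _ _) _; rewrite leq_subLR;
   rewrite -sum1_card addnS ltnS -big_split /=; apply: leq_sum => i _;
   by rewrite add1n).
Qed.

(** A morphism that kills neither leading coefficient commutes with the resultant, so coprimality
    may be tested after specialization. *)
Lemma resultant_neq0 (aR : nzRingType) (rR : fieldType)
    (phi : {rmorphism {poly aR} -> rR}) (p q : {poly {poly aR}}) :
  phi (lead_coef p) != 0 -> phi (lead_coef q) != 0 ->
  coprimep (map_poly phi p) (map_poly phi q) -> resultant p q != 0.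
Proof.
move=> p0 q0; rewrite coprimep_def => /eqP cpq.
apply: contraTneq isT => r0; have := map_resultant p0 q0.
by rewrite r0 rmorph0 => /esym/eqP; rewrite resultant_eq0 cpq.
Qed.

Section Independence.

Variables (K : closedFieldType) (s : nat).

(* The outer variable is X; the inner variable Z is replaced by X^s. *)
Definition eval_XXs : {poly {poly K}} -> {poly K} :=
  horner_eval 'X \o map_poly (comp_poly 'X^s).
HB.instance Definition _ := GRing.RMorphism.copy eval_XXs
  (horner_eval 'X \o map_poly (comp_poly 'X^s)).

Lemma eval_XXsE (u : {poly {poly K}}) :
  eval_XXs u = \sum_(i < size u) (u`_i \Po 'X^s) * 'X^i.
Proof.
rewrite /eval_XXs /= horner_evalE (@horner_coef_wide _ (size u)) ?size_poly //.
by apply: eq_bigr => i _; rewrite coef_map.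
Qed.

(** The monomial [Z^j X^i] goes to [X^(j s + i)], and for [i < s] these exponents are distinct,
    being expansions in base [s]. *)
Lemma eval_XXs_neq0 (u : {poly {poly K}}) :
  (size u <= s)%N -> u != 0 -> eval_XXs u != 0.
Proof.
move=> us; apply: contra => /eqP E; apply/eqP/polyP => i; rewrite coef0.
have [ui|iu] := leqP (size u) i; first by rewrite nth_default.
have s0 : (0 < s)%N by apply: leq_ltn_trans (leq_trans iu us).
apply/polyP => j; rewrite coef0.
have /(congr1 (fun p : {poly K} => p`_(j * s + i))) := E.
rewrite eval_XXsE coef0 coef_sum (bigD1 (Ordinal iu)) //= big1 ?addr0 => [|k ki].
  by rewrite coefMXn ltnNge leq_addl /= addnK coef_comp_poly_Xn // dvdn_mull // mulnK.
have ks : (k < s)%N by apply: leq_trans (ltn_ord k) us.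
have is_ : (i < s)%N by apply: leq_trans us.
rewrite coefMXn; case: ltnP => // kj; rewrite coef_comp_poly_Xn //.
case: dvdnP => // -[t Ht]; case/eqP: ki; apply: val_inj => /=.
have : (j * s + i = t * s + k)%N by rewrite -Ht subnK.
by move/(congr1 (modn^~ s)); rewrite !modnMDl !modn_small.
Qed.

(** Some fixed power of [Z] has a coefficient in [L] that is a nonzero polynomial in [X]; its
    product with [f] has a non-root, as [K] is infinite. *)
Lemma specialization_exists (L : {poly {poly K}}) (f : {poly K}) :
  L != 0 -> f != 0 -> exists x0 : K, L.[x0%:P] != 0 /\ f.[x0] != 0.
Proof.
move=> L0 f0; pose j := (size (lead_coef L)).-1.
pose l := map_poly (coefp j) L.
have l0 : l != 0.
  apply/eqP => /(congr1 (fun p : {poly K} => p`_(size L).-1)).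
  rewrite coef_map coef0 /= -/(lead_coef _) -/(lead_coef _) => /eqP.
  by rewrite !lead_coef_eq0 (negPf L0).
have /closed_nonrootP[x0] : l * f != 0 by rewrite mulf_neq0.
rewrite rootE hornerM mulf_eq0 negb_or => /andP[lx fx].
exists x0; split=> //; apply: contra lx => /eqP /(congr1 (coefp j)) /=.
rewrite coef0 horner_coef coef_sum => E.
rewrite (@horner_coef_wide _ (size L)) ?size_poly // -[X in _ == X]E.
by apply/eqP; apply: eq_bigr => i _; rewrite coef_map /= -polyC_exp coefMC.
Qed.

Definition specialize (x0 : K) : {poly {poly K}} -> {fraction {poly K}} :=
  @FracField.tofrac _ \o horner_eval x0%:P.
HB.instance Definition _ x0 := GRing.RMorphism.copy (specialize x0)
  (@FracField.tofrac _ \o horner_eval x0%:P).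

Lemma specializeE x0 u : specialize x0 u = FracField.tofrac u.[x0%:P].
Proof. by []. Qed.

(* The resultant in Y of P and f(X) Y^d - f(Z) has X-degree less than s, so it does
   not vanish at Z = X^s, where f^n is a root of f(X) Y^d - f(Z). *)
Lemma independence (d n D : nat) (f : {poly K}) (P : {poly {poly {poly K}}}) :
  s = (d * n).+1 -> f \Po 'X^s = f ^+ s -> size f = D.+1 -> power_free d f ->
  P != 0 -> (size P <= d)%N -> (forall i, (size (P`_i)%R + D <= n.+1)%N) ->
  (map_poly eval_XXs P).[f ^+ n] != 0.
Proof.
move=> sE fs sf pf P0 sP Pn.
have f0 : f != 0 by rewrite -size_poly_gt0 sf.
have d0 : (0 < d)%N by apply: leq_trans sP; rewrite size_poly_gt0.
have Dn : (D <= n)%N.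
  have := Pn (size P).-1; rewrite -/(lead_coef P).
  have : (0 < size (lead_coef P))%N by rewrite size_poly_gt0 lead_coef_eq0.
  by lia.
(* The resultant argument needs positive degree in Y, so [P] constant in Y is treated apart. *)
have [sP1|sP1] := leqP (size P) 1.
  have PE := size1_polyC sP1; rewrite PE map_polyC hornerC /=.
  apply: eval_XXs_neq0; last by apply: contra P0; rewrite [in X in _ -> X]PE => /eqP->.
  by rewrite sE; apply: leq_trans (_ : n.+1 <= _)%N; [exact: leq_trans (leq_addr D _) (Pn 0%N) | rewrite ltnS leq_pmull].
pose W : {poly {poly {poly K}}} := f^:P *: 'X^d - (f%:P)%:P.
have fP0 : f^:P != 0 by rewrite map_polyC_eq0.
have sW : size W = d.+1.
  rewrite size_polyDl size_scale ?size_polyXn // size_polyN size_polyC.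
  by apply: leq_ltn_trans (leq_b1 _) _.
have lW : lead_coef W = f^:P.
  rewrite lead_coefDl ?lead_coefZ ?lead_coefXn ?mulr1 //.
  rewrite size_scale ?size_polyXn // size_polyN size_polyC.
  by apply: leq_ltn_trans (leq_b1 _) _.
(* Setting X to a suitable [x0] leaves polynomials in Y over [K(Z)], where [coprime_binomial]
   applies with the constant [f.[x0]]. *)
have N0 : resultant P W != 0.
  have LP0 : lead_coef P != 0 by rewrite lead_coef_eq0.
  have [x0 [Lx fx]] := specialization_exists LP0 f0.
  have fE : specialize x0 f^:P = FracField.tofrac (f.[x0])%:P.
    by rewrite specializeE horner_map.
  apply: (@resultant_neq0 _ _ (specialize x0)).
  - by rewrite /= specializeE tofrac_eq0.
  - by rewrite /= lW fE tofrac_eq0 polyC_eq0.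
  have -> : map_poly (specialize x0) W =
      FracField.tofrac (f.[x0])%:P *: 'X^d - (FracField.tofrac f)%:P.
    rewrite rmorphB /= map_polyZ map_polyXn map_polyC /= fE; congr (_ - _%:P).
    by rewrite /= specializeE hornerC.
  apply: coprime_binomial => //; last exact: leq_trans (size_poly _ _) sP.
  by rewrite map_poly_eq0_id0 //= specializeE tofrac_eq0.
(* In the Sylvester matrix, [d] rows hold coefficients of [P], of X-degree at most [n - D], and at
   most [d - 1] rows hold those of [W], of X-degree at most [D]. The total is at most
   [d n = s - 1]. *)
have sN : (size (resultant P W) <= s)%N.
  pose b (i : 'I_((size W).-1 + (size P).-1)) :=
    match split i with inl _ => (n - D)%N | inr _ => D end.
  apply: (@leq_trans (\sum_i b i).+1).
    apply: size_det_leq => i j; rewrite Sylvester_mxE /b.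
    case: (split i) => k; case: (_ <= j)%N; rewrite ?coef0 ?mulr0n ?size_poly0 ?mulr1n //=.
    by rewrite -(leq_add2r D) addSn subnK // Pn.
    rewrite coefB coefZ coefXn coefC; apply: leq_trans (size_polyD _ _) _.
    rewrite geq_max size_polyN.
    apply/andP; split.
      by case: eqP; rewrite ?mulr1 ?mulr0 ?size_poly0 // size_map_polyC sf.
    by case: eqP; rewrite ?size_poly0 // (leq_trans (size_polyC_leq1 _)).
  rewrite big_split_ord /=.
  rewrite (eq_bigr (fun=> (n - D)%N)) => [|i _]; last first.
    by rewrite /b; case: split_ordP => // k /eqP; rewrite eq_lrshift.
  rewrite [X in (_ + X)%N](eq_bigr (fun=> D)) => [|i _]; last first.
    by rewrite /b; case: split_ordP => // k /eqP; rewrite eq_rlshift.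
  rewrite !sum_nat_const !card_ord sW /= sE ltnS.
  by move: sP sP1 Dn; case: (size P) => // p; nia.
have sW1 : (1 < size W)%N by rewrite sW ltnS.
(* The resultant is a combination of [P] and [W]. Under Z = X^s and Y = f^n, [W] becomes
   [f^(1 + n d) - f^s = 0], so if [P] vanished there the resultant would too. *)
have [uv _ Nuv] := resultant_in_ideal sP1 sW1.
have : eval_XXs (resultant P W) != 0 by exact: eval_XXs_neq0.
apply: contra => /eqP PE.
have /(congr1 (fun p => (map_poly eval_XXs p).[f ^+ n])) := Nuv.
rewrite map_polyC hornerC /= => ->; rewrite rmorphD !rmorphM /= hornerD !hornerM PE mulr0 add0r.
rewrite /W rmorphB /= map_polyZ map_polyXn map_polyC hornerD hornerN hornerZ hornerXn hornerC /=.
have -> : eval_XXs f^:P = f.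
  rewrite /eval_XXs /= horner_evalE -map_poly_comp.
  rewrite (eq_map_poly (g := polyC)) => [|x /=]; last by rewrite comp_polyC.
  by rewrite -[RHS]comp_polyXr.
have -> : eval_XXs f%:P = f ^+ s.
  by rewrite /eval_XXs /= horner_evalE map_polyC hornerC /=.
by rewrite -exprM -exprS mulnC -sE subrr mulr0.
Qed.

End Independence.

(** * Stepanov's method *)


Lemma linear_dependence (K : fieldType) (I : finType) (v : I -> {poly K}) E :
  (forall i, (size (v i) <= E)%N) -> (E < #|I|)%N ->
  exists c : I -> K, (exists i, c i != 0) /\ \sum_i c i *: v i = 0.
Proof.
move=> vE EI; pose A := \matrix_(i < #|I|, j < E) (v (enum_val i))`_j.
have kA : kermx A != 0.
  rewrite kermx_eq0 /row_free; apply: contraTneq EI => <-.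
  by rewrite -leqNgt rank_leq_col.
have [i ci] : exists i, row i (kermx A) != 0.
  by apply/existsP; rewrite -negb_forall; apply: contra kA => /forallP A0;
    apply/eqP/row_matrixP => i; rewrite row0; apply/eqP.
pose r := row i (kermx A).
have rA : r *m A = 0 by rewrite -row_mul mulmx_ker row0.
exists (fun t => r 0 (enum_rank t)); split.
  have [j rj] : exists j, r 0 j != 0.
    apply/existsP; rewrite -negb_forall; apply: contra ci => /forallP r0.
    by apply/eqP/rowP => j; rewrite -/r [RHS]mxE; apply/eqP.
  by exists (enum_val j); rewrite enum_valK.
apply/polyP => j; rewrite coef0 coef_sum.
have [jE|Ej] := ltnP j E; last first.
  by apply: big1 => t _; rewrite coefZ nth_default ?mulr0 // (leq_trans (vE t)).
have := congr1 (fun M : 'rV_E => M 0 (Ordinal jE)) rA; rewrite mxE [RHS]mxE => rj; rewrite -[RHS]rj.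
rewrite (reindex (@enum_val I I)) /=; last exact/onW_bij/enum_val_bij.
by apply: eq_bigr => k _; rewrite coefZ enum_valK [A _ _]mxE.
Qed.

Lemma expr_sum_pchar (R : comNzSemiRingType) (I : Type) (r : seq I) (g : I -> R) s :
  [pchar R].-nat s -> (\sum_(i <- r) g i) ^+ s = \sum_(i <- r) g i ^+ s.
Proof.
move=> ss; have s0 : (0 < s)%N by case/andP: ss.
elim: r => [|i r IH]; first by rewrite !big_nil expr0n gtn_eqF.
by rewrite !big_cons exprDn_pchar // IH.
Qed.

Lemma closed_root_ex (K : closedFieldType) (s : nat) :
  (0 < s)%N -> exists root : K -> K, forall x, root x ^+ s = x.
Proof.
move=> s0.
have ex x : exists y : K, y ^+ s == x.
  have [y] : exists y, root ('X^s - x%:P : {poly K}) y.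
    by apply/closed_rootP; rewrite size_XnsubC // eqSS -lt0n.
  by rewrite rootE !hornerE subr_eq0; exists y.
by exists (fun x => xchoose (ex x)) => x; apply/eqP; exact: (xchooseP (ex x)).
Qed.

Section Stepanov.

Variables (K : closedFieldType) (s s' d n n' D : nat) (f : {poly K}).
Hypothesis s_pchar : [pchar K].-nat s.
Hypotheses (sE : s = (d * n).+1) (s'E : s' = (d * n').+1).
Hypotheses (nn' : (n <= n')%N) (d2 : (1 < d)%N) (n'_large : (D + 2 * D ^ 2 <= n')%N).
Hypotheses (size_f : size f = D.+1) (f_s' : f \Po 'X^s' = f ^+ s').
Hypothesis pf_f : power_free d f.

(** [B] bounds the powers of X inside [w_ij] and is the largest value that the degree condition of
    [independence] allows; [J] bounds the powers of [X^s']. *)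
Let B := (n' - D).+1.
Let J := (n + D).+1.
Let I : finType := ('I_d * ('I_J * 'I_B))%type.

(** Unknowns outnumber equations. As [s = d n + 1], the leading terms [d n (n' - D)] cancel, and the
    remainder is positive because [n <= n'] and [n' - D >= 2 D^2]. *)
Lemma stepanov_count :
  ((s * (n' - D) + d.-1 * D * n + J) < #|I|)%N.
Proof.
rewrite !card_prod !card_ord /J /B sE.
have [t tE] : exists t, n' = (t + D)%N by exists (n' - D)%N; lia.
have [e eE] : exists e, d = e.+2 by exists (d - 2)%N; lia.
have t2 : (2 * D ^ 2 <= t)%N by lia.
have nt : (n <= t + D)%N by lia.
rewrite tE addnK eE /=.
nia.
Qed.

(* The auxiliary polynomial is rho = sum_(i,j) w_ij f^(n' i) X^(j s').  At a point
   x = x^(s s') with f(x)^(n s' + n') = a, the power rho(x)^s times f(x)^(n (d-1))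
   is the value at x of sum_(i,j) w_ij^s a^i f^(n (d-1-i)) X^j, and the w_ij are
   chosen so that this last polynomial vanishes identically. *)
Lemma stepanov_bound (a : K) (T : seq K) :
  uniq T ->
  (forall x, x \in T ->
     [/\ x ^+ (s * s') = x, f.[x] ^+ (n * s' + n') = a & f.[x] != 0]) ->
  (size T <= n * s' + (2 * D + 1) * s')%N.
Proof.
move=> uT Tx.
have f0 : f != 0 by rewrite -size_poly_gt0 size_f.
pose v (t : I) := a ^+ t.1 *: (f ^+ (n * (d.-1 - t.1)) * 'X^(s * t.2.2 + t.2.1)).
have vE t : (size (v t) <= s * (n' - D) + d.-1 * D * n + J)%N.
  apply: leq_trans (size_scale_leq _ _) _.
  apply: leq_trans (size_polyMleq _ _) _; rewrite size_polyXn addnS /=.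
  have : (size (f ^+ (n * (d.-1 - t.1))) <= (D * (n * (d.-1 - t.1))).+1)%N.
    by apply: leq_trans (size_poly_exp_leq _ _) _; rewrite size_f.
  have := ltn_ord t.2.1; have := ltn_ord t.2.2; have := ltn_ord t.1.
  move: (nat_of_ord t.1) (nat_of_ord t.2.1) (nat_of_ord t.2.2) => i j b id_ bB jJ.
  move: (size (f ^+ _)) => z zE.
  have : (s * b <= s * (n' - D))%N by rewrite leq_mul2l -ltnS bB orbT.
  have : (D * (n * (d.-1 - i)) <= d.-1 * D * n)%N.
    have := leq_subr i d.-1; move: (d.-1 - i)%N => y yd.
    apply: (@leq_trans (D * (n * d.-1))%N); first by rewrite !leq_mul2l yd !orbT.
    by rewrite [X in (_ <= X)%N]mulnAC mulnC [(n * _)%N]mulnC.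
  lia.
have [c [[t0 ct0] cv]] := linear_dependence vE stepanov_count.
have s0 : (0 < s)%N by rewrite sE.
(* The linear system was solved for the [s]-th powers of the coefficients of [rho], so [s]-th roots
   are now extracted. *)
have [rt rtE] := @closed_root_ex K s s0.
pose rho := \sum_(t : I) rt (c t) *: ('X^(t.2.2 + t.2.1 * s') * f ^+ (n' * t.1)).
have rho_root x : x \in T -> root rho x.
  move=> /Tx[xx fa fx].
  suff : rho.[x] ^+ s * f.[x] ^+ (n * d.-1) == 0.
    by rewrite mulf_eq0 !expf_eq0 (negPf fx) andbF orbF => /andP[].
  have := congr1 (horner^~ x) cv; rewrite /= horner0 => <-.
  rewrite /rho !horner_sum expr_sum_pchar // mulr_suml; apply/eqP/eq_bigr => t _.
  rewrite /v !hornerZ !hornerM !hornerXn !horner_exp !exprMn rtE.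
  have -> : x ^+ (t.2.2 + t.2.1 * s') ^+ s = x ^+ (s * t.2.2 + t.2.1).
    rewrite -exprM mulnDl exprD [RHS]exprD mulnC; congr (_ * _).
    by rewrite -mulnA mulnC [(s' * s)%N]mulnC exprM xx.
  rewrite -fa -!exprM -!mulrA; congr (_ * _).
  rewrite [RHS]mulrA -exprD [RHS]mulrC -exprD; congr (_ * _ ^+ _).
  (* The exponents of [f] agree because [n' s = (n s' + n') - n], both sides being [d n n' + n']. *)
  have := ltn_ord t.1; rewrite sE s'E.
  move: (nat_of_ord t.1) => i id_; have [e ->] : exists e, d = (i + e).+1 by exists (d - i.+1)%N; lia.
  by rewrite /= addKn; nia.
have rho0 : rho != 0.
  pose P : {poly {poly {poly K}}} :=
    \sum_(t : I) ((rt (c t) *: 'X^(t.2.1))%:P * 'X^(t.2.2))%:P * 'X^(t.1).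
  have Pcoef i : P`_i = \sum_(t : I | i == t.1) (rt (c t) *: 'X^(t.2.1))%:P * 'X^(t.2.2).
    rewrite coef_sum [RHS]big_mkcond; apply: eq_bigr => t _.
    by rewrite coefCM coefXn; case: eqP; rewrite ?mulr1 ?mulr0.
  have -> : rho = (map_poly (eval_XXs s') P).[f ^+ n'].
    rewrite rmorph_sum /= horner_sum; apply: eq_bigr => t _.
    rewrite rmorphM /= map_polyC map_polyXn hornerM hornerC hornerXn -exprM.
    rewrite /= /eval_XXs /= horner_evalE rmorphM /= map_polyC map_polyXn hornerM hornerXn.
    rewrite hornerC /= comp_polyZ comp_Xn_poly -exprM scalerAl.
    by rewrite exprD -[in RHS]scalerAl ['X^(t.2.2) * _]mulrC [(s' * _)%N]mulnC.
  apply: (@independence K s' d n' D) => //.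
  - apply/eqP => /(congr1 (fun p : {poly {poly {poly K}}} => p`_(t0.1)`_(t0.2.2)`_(t0.2.1))).
    rewrite Pcoef !coef0 !coef_sum (bigD1 t0) //= big1 => [|t /andP[/eqP t1 tt0]].
      rewrite coefCM coefXn eqxx mulr1 coefZ coefXn eqxx mulr1 addr0 => r0.
      by case/eqP: ct0; rewrite -[c t0]rtE r0 expr0n gtn_eqF.
    rewrite coefCM coefXn; case: eqP => [t2|_]; last by rewrite mulr0 coef0.
    rewrite mulr1 coefZ coefXn; case: eqP => [t3|_]; last by rewrite mulr0.
    case/eqP: tt0; case: t t0 t1 t2 t3 {ct0} => [x [y z]] [x0 [y0 z0]] /=.
    by move=> /val_inj-> /val_inj-> /val_inj->.
  - apply/leq_sizeP => j dj; rewrite Pcoef big_pred0 // => t.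
    by apply: gtn_eqF; apply: leq_trans dj.
  - move=> i; have -> : n'.+1 = (B + D)%N by rewrite /B addSn subnK //; lia.
    rewrite leq_add2r Pcoef; apply/leq_sizeP => j Bj; rewrite coef_sum big1 // => t _.
    by rewrite coefCM coefXn gtn_eqF ?mulr0 // (leq_trans _ Bj).
have : (size T < size rho)%N.
  by apply: max_poly_roots => //; apply/allP => x; apply: rho_root.
suff : (size rho <= (n * s' + (2 * D + 1) * s').+1)%N.
  by move=> h1 h2; rewrite -ltnS (leq_trans h2 h1).
(* The degree has three parts: [(n + D) s'] at most from [X^(j s')], [D s'] from the power of [f],
   and [s'] from the powers of X below [B]. *)
apply: leq_trans (size_sum _ _ _) _; apply/bigmax_leqP => t _.
apply: leq_trans (size_scale_leq _ _) _.
apply: leq_trans (size_polyMleq _ _) _; rewrite size_polyXn addSn /=.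
have : (size (f ^+ (n' * t.1)) <= (D * (n' * t.1)).+1)%N.
  by apply: leq_trans (size_poly_exp_leq _ _) _; rewrite size_f.
have := ltn_ord t.2.1; have := ltn_ord t.2.2; have := ltn_ord t.1.
move: (nat_of_ord t.1) (nat_of_ord t.2.1) (nat_of_ord t.2.2) => i j b id_ bB jJ.
move: (size (f ^+ _)) => z zE.
have h1 : (j * s' <= (n + D) * s')%N by rewrite leq_mul2r -ltnS jJ orbT.
have h2 : (D * (n' * i) <= D * (d * n'))%N.
  by rewrite leq_mul2l [(n' * i)%N]mulnC leq_mul2r ltnW ?orbT.
have h3 : (b <= s')%N by move: bB; rewrite /B s'E; nia.
have h4 : (D * s' = D * (d * n') + D)%N by rewrite s'E; nia.
move: zE; nia.
Qed.

End Stepanov.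

(** * Frobenius orbits in the algebraic closure *)


(** The argument [emb] ties the characteristic of [K] to that of [F], which the morphism structure
    of [frob emb] relies on. *)
Definition frob (F : finFieldType) (K : closedFieldType)
  (emb : {rmorphism F -> K}) (x : K) : K := x ^+ #|F|.

Section Frobenius.

Variables (F : finFieldType) (K : closedFieldType) (emb : {rmorphism F -> K}).
Let q := #|F|.

Lemma card_gt1 : (1 < q)%N. Proof. exact: finNzRing_gt1. Qed.

Lemma card_pchar m : [pchar K].-nat (q ^ m)%N.
Proof.
have [p pp pF] := finPcharP F.
have pK : p \in [pchar K] by rewrite (rmorph_pchar emb).
by rewrite /q (card_pprimeChar pF) -expnM pnatX pnatE // pK.
Qed.

Lemma frob_subX m x y : (x - y) ^+ (q ^ m) = x ^+ (q ^ m) - y ^+ (q ^ m) :> K.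
Proof.
rewrite exprDn_pchar ?card_pchar //; congr (_ + _).
by rewrite exprNn_pchar ?card_pchar.
Qed.

Lemma frob_injX m : injective (fun x : K => x ^+ (q ^ m)).
Proof.
move=> x y /eqP; rewrite -subr_eq0 -frob_subX expf_eq0 => /andP[_].
by rewrite subr_eq0 => /eqP.
Qed.

Local Notation frob := (frob emb).

Lemma frob_zmod : zmod_morphism frob.
Proof. by move=> x y; have := frob_subX 1 x y; rewrite expn1. Qed.

Lemma frob_monoid : monoid_morphism frob.
Proof. by split=> [|x y]; rewrite /frob ?expr1n // exprMn. Qed.

HB.instance Definition _ := GRing.isZmodMorphism.Build K K frob frob_zmod.
HB.instance Definition _ := GRing.isMonoidMorphism.Build K K frob frob_monoid.

Lemma frob_emb a : frob (emb a) = emb a.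
Proof. by rewrite /frob -rmorphXn /= expf_card. Qed.

Definition emb_inv (y : K) : F := odflt 0 [pick x | emb x == y].

Lemma embK : cancel emb emb_inv.
Proof.
move=> x; rewrite /emb_inv; case: pickP => [y /eqP /fmorph_inj //|/(_ x)].
by rewrite eqxx.
Qed.

(** The polynomial [X^q - X] already splits over [F], so the fixed points of Frobenius are the image
    of [emb]. *)
Lemma emb_invK y : frob y = y -> emb (emb_inv y) = y.
Proof.
move=> fy; suff [x ->] : exists x, y = emb x by rewrite embK.
have := congr1 (horner^~ y \o map_poly emb) (finField_genPoly F).
rewrite /= rmorphB /= map_polyXn map_polyX !hornerE -/(frob y) fy subrr.
rewrite rmorph_prod horner_prod => /esym/eqP/prodf_eq0[x _].
by rewrite /= map_polyXsubC hornerXsubC subr_eq0 => /eqP; exists x.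
Qed.

Definition descend (p : {poly K}) : {poly F} := map_poly emb_inv p.

Lemma descendK p : map_poly frob p = p -> map_poly emb (descend p) = p.
Proof.
move=> fp; apply/polyP => i; rewrite coef_map /= coef_map_id0 /=; last first.
  by apply: (fmorph_inj emb); rewrite emb_invK ?rmorph0.
by apply: emb_invK; rewrite -[in RHS]fp coef_map.
Qed.

(* If x ^+ (q ^ m) = x, this is the characteristic polynomial over F of x as an
   element of the field with q ^ m elements. *)
Definition orbit_poly m (x : K) := \prod_(i < m) ('X - (x ^+ (q ^ i))%:P).

Lemma orbit_poly_monic m x : orbit_poly m x \is monic.
Proof. by apply: monic_prod => i _; apply: monicXsubC. Qed.

Lemma size_orbit_poly m x : size (orbit_poly m x) = m.+1.
Proof. by rewrite /orbit_poly size_prod_XsubC /index_enum -enumT size_enum_ord. Qed.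

Definition frob_orbit m (x : K) := [seq x ^+ (q ^ i) | i <- iota 0 m].

Lemma orbit_polyE m x : orbit_poly m x = \prod_(y <- frob_orbit m x) ('X - y%:P).
Proof. by rewrite big_map -[m in iota 0 m]subn0 big_mkord. Qed.

(** Frobenius permutes the factors cyclically; hence the polynomial has coefficients in [F]. *)
Lemma orbit_poly_frob m x :
  x ^+ (q ^ m) = x -> map_poly frob (orbit_poly m x) = orbit_poly m x.
Proof.
case: m => [|m] xm; first by rewrite /orbit_poly !big_ord0 rmorph1.
rewrite /orbit_poly rmorph_prod /= big_ord_recr [RHS]big_ord_recl [RHS]mulrC /=.
congr (_ * _).
  by apply: eq_bigr => i _; rewrite map_polyXsubC /= /frob -exprM -expnSr.
by rewrite map_polyXsubC /= /frob -exprM -expnSr xm expn0 expr1.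
Qed.

Lemma orbit_polyD r m x : x ^+ (q ^ r) = x ->
  orbit_poly (r + m) x = orbit_poly r x * orbit_poly m x.
Proof.
move=> xr; rewrite /orbit_poly big_split_ord /=; congr (_ * _).
by apply: eq_bigr => i _; rewrite expnD exprM xr.
Qed.

Lemma root_orbit_poly m x : (0 < m)%N -> root (orbit_poly m x) x.
Proof.
move=> m0; rewrite orbit_polyE root_prod_XsubC; apply/mapP; exists 0%N.
  by rewrite mem_iota.
by rewrite expn0 expr1.
Qed.

Lemma root_frob (u : {poly F}) x m :
  root (map_poly emb u) x -> root (map_poly emb u) (x ^+ (q ^ m)).
Proof.
move=> ux; elim: m => [|m IH]; first by rewrite expn0 expr1.
rewrite expnSr exprM -/(frob _) rootE.
have -> : map_poly emb u = map_poly frob (map_poly emb u).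
  by rewrite -map_poly_comp; apply: eq_map_poly => a /=; rewrite frob_emb.
by rewrite horner_map fmorph_eq0.
Qed.

Lemma period_cancel (x : K) i j : (i <= j)%N ->
  x ^+ (q ^ i) = x ^+ (q ^ j) -> x ^+ (q ^ (j - i)) = x.
Proof.
move=> ij E; apply: (@frob_injX i); rewrite -exprM -expnD addnC subnKC //.
Qed.

Lemma uniq_orbit r (x : K) :
  (forall i, (0 < i < r)%N -> x ^+ (q ^ i) != x) -> uniq (frob_orbit r x).
Proof.
move=> rmin; rewrite map_inj_in_uniq ?iota_uniq // => i j.
wlog ij : i j / (i <= j)%N.
  by move=> W; case/orP: (leq_total i j) => [/W//|/W{}W ? ? /esym /W ->].
rewrite !mem_iota !add0n /= => ir jr /(period_cancel ij) E.
apply/eqP; rewrite eqn_leq ij leqNgt; apply/negP => lt_ij.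
have : (0 < j - i < r)%N by lia.
by move/rmin; rewrite E eqxx.
Qed.

(** The iterates of [x] under Frobenius are all roots of [u], so two of them coincide. *)
Lemma exists_period (u : {poly F}) x : u != 0 -> root (map_poly emb u) x ->
  exists r, (0 < r)%N && (x ^+ (q ^ r) == x).
Proof.
move=> u0 ux; have : ~~ uniq (frob_orbit (size u) x).
  apply/negP => uo; have : (size (frob_orbit (size u) x) < size (map_poly emb u))%N.
    apply: max_poly_roots => //; first by rewrite map_poly_eq0.
    by apply/allP => _ /mapP[i _ ->]; apply: root_frob.
  by rewrite size_map size_iota size_map_poly ltnn.
case/(uniqPn 0) => i [j [ij]]; rewrite size_map size_iota => ju.
have iu : (i < size u)%N by apply: ltn_trans ju.
rewrite !(nth_map 0%N) ?size_iota // !nth_iota // !add0n.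
by move/(period_cancel (ltnW ij)) => E; exists (j - i)%N; rewrite E eqxx subn_gt0 ij.
Qed.

(** Let [r] be the least period of a root [x]. Then [orbit_poly r x] is its minimal polynomial over
    [F], and [orbit_poly m x] is the power [m / r] of it when [r] divides [m]. So the sum counts the
    powers of this irreducible factor that divide [u]. The induction removes one such factor at a
    time. *)
Lemma count_orbit_poly (u : {poly F}) (rs : seq K) (x : K) :
  map_poly emb u = \prod_(z <- rs) ('X - z%:P) ->
  (\sum_(1 <= m < (size rs).+1)
     ((x ^+ (q ^ m) == x) && (orbit_poly m x %| map_poly emb u)%R) = count_mem x rs)%N.
Proof.
elim: (size rs) {-2}rs (leqnn (size rs)) u => [|N IH] {}rs rsN u urs.
  move: rsN; rewrite leqn0 => /nilP rs0; rewrite rs0 /=.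
  by rewrite big_geq.
have [xrs|xrs] := boolP (x \in rs); last first.
  rewrite (count_memPn xrs) big_nat big1 // => m /andP[m0 _].
  case: eqP => //= _; apply/eqP; rewrite eqb0; apply: contra xrs => d.
  by rewrite -root_prod_XsubC -urs; apply: root_dvdp d _; apply: root_orbit_poly.
have um : map_poly emb u \is monic by rewrite urs monic_prod_XsubC.
have u0 : u != 0 by rewrite -(map_poly_eq0 emb) monic_neq0.
have ux : root (map_poly emb u) x by rewrite urs root_prod_XsubC.
case: (ex_minnP (exists_period u0 ux)) => r /andP[r0 /eqP xr] rmin.
have uo : uniq (frob_orbit r x).
  apply: uniq_orbit => i /andP[i0 ir]; apply: contraTneq ir => xi.
  by rewrite -leqNgt; apply: rmin; rewrite i0 xi eqxx.
have ou : orbit_poly r x %| map_poly emb u.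
  rewrite orbit_polyE; apply: uniq_roots_dvdp; last by rewrite uniq_rootsE.
  by apply/allP => _ /mapP[i _ ->]; apply: root_frob.
have PE := descendK (orbit_poly_frob xr).
have := ou; rewrite -{1}PE dvdp_map => /dvdpP[u' uu'].
have uE : map_poly emb u = map_poly emb u' * orbit_poly r x by rewrite uu' rmorphM /= PE.
have u'm : map_poly emb u' \is monic.
  by rewrite -(monicMr _ (orbit_poly_monic r x)) -uE.
have [rs' ] := closed_field_poly_normal (map_poly emb u').
rewrite (monicP u'm) scale1r => u'rs.
have prs : perm_eq rs (rs' ++ frob_orbit r x).
  by apply: prod_XsubC_eq; rewrite big_cat /= -u'rs -orbit_polyE -uE.
have srs : size rs = (size rs' + r)%N.
  by rewrite (perm_size prs) size_cat size_map size_iota.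
have rs'N : (size rs' <= N)%N by move: rsN r0; rewrite srs; lia.
rewrite (seq.permP prs) count_cat -(IH rs' rs'N u' u'rs) [RHS]addnC.
rewrite (count_uniq_mem _ uo) -root_prod_XsubC -orbit_polyE root_orbit_poly //.
(* No [m < r] contributes, [m = r] contributes 1, and the terms beyond [r], shifted down by [r], are
   those of the cofactor [u']. *)
rewrite (@big_cat_nat _ _ _ r.+1) //=; last by rewrite srs ltnS leq_addl.
rewrite big_nat_recr //= xr eqxx ou big_nat big1 => [|m /andP[m0 mr]]; last first.
  case: eqP => //= xm; have := rmin m; rewrite m0 xm eqxx => /(_ isT).
  by rewrite leqNgt mr.
rewrite add0n; congr (_ + _)%N.
rewrite srs -addSn -[r.+1]add1n big_addn addnK; apply: eq_bigr => m _.
by rewrite addnC expnD exprM xr orbit_polyD // uE mulrC dvdp_mul2r // monic_neq0 // orbit_poly_monic.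
Qed.

End Frobenius.

(** * Monic polynomials and norms *)


Section Monics.

Variable F : finFieldType.

Definition low_polys n : seq {poly F} := [seq rVpoly v | v : 'rV[F]_n].
Definition monics n : seq {poly F} := [seq 'X^n + r | r <- low_polys n].

Lemma mem_low_polys n r : (r \in low_polys n) = (size r <= n)%N.
Proof.
apply/imageP/idP => [[v _ ->]|rn]; first exact: size_poly.
by exists (poly_rV r); rewrite ?poly_rV_K.
Qed.

Lemma low_polys_uniq n : uniq (low_polys n).
Proof. by rewrite map_inj_uniq ?enum_uniq //; apply: (can_inj rVpolyK). Qed.

Lemma mem_monics n u : (u \in monics n) = (u \is monic) && (size u == n.+1).
Proof.
apply/mapP/andP => [[r rn ->]|[um /eqP su]].
  rewrite mem_low_polys in rn.
  by rewrite monicE lead_coefDl ?lead_coefXn ?size_polyDl ?size_polyXn ?ltnS.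
exists (u - 'X^n); last by rewrite addrC subrK.
rewrite mem_low_polys; apply/leq_sizeP => j; rewrite leq_eqVlt => /orP[/eqP <-|nj].
  rewrite coefB coefXn eqxx; move/monicP: um; rewrite /lead_coef su /= => ->.
  by rewrite subrr.
by rewrite coefB coefXn gtn_eqF // nth_default ?subrr // su.
Qed.

Lemma monics_uniq n : uniq (monics n).
Proof. by rewrite map_inj_uniq ?low_polys_uniq //; apply: addrI. Qed.

Lemma size_monics n : size (monics n) = (#|F| ^ n)%N.
Proof. by rewrite size_map size_image cardT -cardE card_mx mul1n. Qed.

Lemma perm_monics_dvd n m (P : {poly F}) : P \is monic -> size P = m.+1 -> (m <= n)%N ->
  perm_eq [seq u <- monics n | P %| u] [seq P * w | w <- monics (n - m)].
Proof.
move=> Pm sP mn; have P0 := monic_neq0 Pm; apply: uniq_perm.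
- by rewrite filter_uniq // monics_uniq.
- by rewrite map_inj_uniq ?monics_uniq //; apply: mulfI.
move=> u; rewrite mem_filter mem_monics; apply/andP/mapP => [[/dvdpP[w ->]]|[w]].
  rewrite monicMr // => /andP[wm /eqP]; rewrite size_Mmonic // ?monic_neq0 // sP => sw.
  exists w; last by rewrite mulrC.
  by rewrite mem_monics wm; apply/eqP; move: sw mn; case: (size w) => [|k] /=; lia.
rewrite mem_monics => /andP[wm /eqP sw] ->; rewrite dvdp_mulIl monicMl // wm.
by rewrite mulrC size_Mmonic ?monic_neq0 // sP sw addSn /= addnS subnK.
Qed.

(** This is Euclidean division by [f]: monic polynomials of degree [n] run through each residue
    class modulo [f] equally often. *)
Lemma perm_monics_div n d (f : {poly F}) : f \is monic -> size f = d.+1 -> (d <= n)%N ->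
  perm_eq (monics n) [seq w * f + r | w <- monics (n - d), r <- low_polys d].
Proof.
move=> fm sf dn; have f0 := monic_neq0 fm; apply: uniq_perm.
- exact: monics_uniq.
- apply: allpairs_uniq; rewrite ?monics_uniq ?low_polys_uniq // => -[w r] [w' r'].
  case/allpairsP => -[a b] /= [_ hb [-> ->]] /allpairsP [[a' b']] /= [_ hb' [-> ->]].
  rewrite !mem_low_polys in hb hb' => E.
  have hw : a = a'.
    have := congr1 (fun p => p %/ f) E; rewrite /= !divp_addl_mul ?f0 //.
    by rewrite !divp_small ?sf ?ltnS // !addr0.
  by move: E; rewrite hw => /addrI ->.
move=> u; rewrite mem_monics; apply/andP/allpairsP => [[um /eqP su]|[[w r] /= []]].
  have rd : (size (u %% f)%R <= d)%N by rewrite -ltnS -sf ltn_modpN0.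
  exists (u %/ f, u %% f); rewrite /= -divp_eq mem_low_polys mem_monics rd; split => //.
  have sd : size (u %/ f) = (n - d).+1 by rewrite size_divp // su sf /= subSn.
  rewrite sd eqxx andbT monicE /lead_coef sd /=.
  have := monicP um; rewrite {1}(divp_eq u f) lead_coefDl.
    by rewrite lead_coefM (monicP fm) mulr1 /lead_coef sd /= => ->.
  rewrite size_Mmonic // -?size_poly_gt0 ?sd // sf addSn /= addnS ltnS.
  by rewrite (leq_trans rd) // leq_addl.
rewrite mem_monics mem_low_polys => /andP[wm /eqP sw] rd ->.
have swf : size (w * f) = n.+1 by rewrite size_Mmonic // ?monic_neq0 // sw sf addSn /= addnS subnK.
have rwf : (size r < size (w * f)%R)%N by rewrite swf ltnS (leq_trans rd dn).
by rewrite monicE lead_coefDl // -monicE monicMr // wm size_polyDl // swf.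
Qed.

End Monics.

(** * Products over roots as determinants *)

Section Norm.

Variables (F : finFieldType) (D : nat) (f : {poly F}) (M : 'M[F]_D.+1).
Hypothesis charM : char_poly M = f.

(* The product of f over the roots of u, see norm_poly_roots. *)
Definition norm_poly (u : {poly F}) : F :=
  (-1) ^+ (D.+1 * (size u).-1) * \det (horner_mx M u).

Lemma det_horner_mxM (R : comNzRingType) n (A : 'M[R]_n.+1) (u v : {poly R}) :
  \det (horner_mx A (u * v)) = \det (horner_mx A u) * \det (horner_mx A v).
Proof. by rewrite rmorphM /= det_mulmx. Qed.

Lemma norm_polyM u v : u \is monic -> v \is monic ->
  norm_poly (u * v) = norm_poly u * norm_poly v.
Proof.
move=> um vm; rewrite /norm_poly det_horner_mxM mulrACA -exprD -mulnDr.
rewrite size_Mmonic ?monic_neq0 //.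
have := monic_neq0 um; have := monic_neq0 vm; rewrite -!size_poly_gt0.
by case: (size u) => // a; case: (size v) => // b _ _; rewrite addSn /= addnS.
Qed.

Lemma det_sub_char (R : comNzRingType) n (A : 'M[R]_n) (a : R) :
  \det (A - a%:M) = (-1) ^+ n * (char_poly A).[a].
Proof.
have -> : (char_poly A).[a] = \det (a%:M - A).
  rewrite -[LHS]/(horner_eval a (char_poly A)) -det_map_mx; congr (\det _).
  by apply/matrixP => i j; rewrite !mxE /= /horner_eval !hornerE hornerMn hornerX.
by rewrite -detZ scaleN1r opprB.
Qed.

(** If [u] has roots [z], then [u(M)] is the product of the [M - z], and [\det (M - z)] is [f(z)] up
    to the sign that [norm_poly] compensates. *)
Lemma norm_poly_roots (K : fieldType) (emb : {rmorphism F -> K}) u rs :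
  map_poly emb u = \prod_(z <- rs) ('X - z%:P) ->
  emb (norm_poly u) = \prod_(z <- rs) (map_poly emb f).[z].
Proof.
move=> urs; have su : (size u).-1 = size rs.
  by rewrite -(size_map_poly emb) urs size_prod_XsubC.
rewrite /norm_poly rmorphM rmorph_sign su /= -det_map_mx map_horner_mx urs.
elim: rs {urs su} => [|z rs IH]; first by rewrite !big_nil muln0 rmorph1 det1 mulr1.
rewrite !big_cons -IH det_horner_mxM mulnS exprD mulrACA; congr (_ * _).
rewrite rmorphB /= horner_mx_X horner_mx_C det_sub_char mulrA -exprD addnn -mul2n mulnC exprM sqrr_sign mul1r.
by rewrite -charM map_char_poly.
Qed.

End Norm.

(** * The subfields with [q ^ m] elements *)

Section FrobeniusFixed.

Variables (F : finFieldType) (K : closedFieldType) (emb : {rmorphism F -> K}).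
Let q := #|F|.

Lemma card_exp_gt1 m : (0 < m)%N -> (1 < q ^ m)%N.
Proof.
move=> m0; apply: leq_trans (card_gt1 F) _.
by rewrite -[X in (X <= _)%N]expn1 leq_pexp2l // ltnW ?card_gt1.
Qed.

Definition frob_fixed (m : nat) : seq K :=
  sval (closed_field_poly_normal ('X^(#|F| ^ m) - 'X : {poly K})).

Lemma frob_fixedE m : (0 < m)%N ->
  'X^(q ^ m) - 'X = \prod_(z <- frob_fixed m) ('X - z%:P).
Proof.
move=> m0; rewrite /frob_fixed; case: closed_field_poly_normal => r /= {1}->.
rewrite lead_coefDl ?lead_coefXn ?scale1r // size_polyN size_polyX size_polyXn ltnS.
exact: card_exp_gt1.
Qed.

Lemma mem_frob_fixed m x : (0 < m)%N -> (x \in frob_fixed m) = (x ^+ (q ^ m) == x).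
Proof.
move=> m0; by rewrite -root_prod_XsubC -frob_fixedE // rootE !hornerE subr_eq0.
Qed.

(** The derivative of [X^(q^m) - X] is -1, so its roots are simple. *)
Lemma frob_fixed_uniq m : (0 < m)%N -> uniq (frob_fixed m).
Proof.
move=> m0; rewrite -separable_prod_XsubC -frob_fixedE // unlock.
have q0 : (q ^ m)%:R = 0 :> K.
  rewrite natrX; have -> : q%:R = 0 :> K; last by rewrite expr0n gtn_eqF.
  rewrite -(rmorph_nat emb) -[X in emb X](_ : 0 = _) ?rmorph0 //.
  by rewrite -FinRing.Theory.zmodXgE /q -cardsT expg_cardG ?inE.
rewrite derivB derivXn derivX -scaler_nat q0 scale0r sub0r -[X in coprimep _ X]scaleN1r.
by rewrite coprimepZr ?coprimep1 // oppr_eq0 oner_eq0.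
Qed.

Lemma size_frob_fixed m : (0 < m)%N -> size (frob_fixed m) = (q ^ m)%N.
Proof.
move=> m0; apply: succn_inj; rewrite -(size_prod_XsubC _ id) -frob_fixedE //.
rewrite size_polyDl ?size_polyXn // size_polyN size_polyX ltnS.
exact: card_exp_gt1.
Qed.

End FrobeniusFixed.

(** * The L-function of a character sum *)


Section LFunction.

Variables (F : finFieldType) (K : closedFieldType) (emb : {rmorphism F -> K}).
Variables (D : nat) (f : {poly F}) (M : 'M[F]_D.+1) (chi : F -> algC).
Hypotheses (charM : char_poly M = f).
Hypotheses (chi1 : chi 1 = 1) (chiM : {morph chi : x y / x * y}).
Let q := #|F|.

Let f_monic : f \is monic.
Proof. by rewrite -charM char_poly_monic. Qed.

Let size_f : size f = D.+2.
Proof. by rewrite -charM size_char_poly. Qed.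

(** On [X - a] this is [chi f.[a]]; on monic polynomials it is the multiplicative extension. *)
Definition char_norm (u : {poly F}) : algC := chi (norm_poly M u).

Definition L_coef (n : nat) : algC := \sum_(u <- monics F n) char_norm u.

(** By [norm_orbit_poly], for [m > 0] this is the sum of [chi] of the norm of [f(x)] over the field
    with [q^m] elements. *)
Definition power_sum (m : nat) : algC :=
  \sum_(x <- frob_fixed F K m) char_norm (descend emb (orbit_poly F m x)).

Lemma char_normM u v : u \is monic -> v \is monic -> char_norm (u * v) = char_norm u * char_norm v.
Proof. by move=> um vm; rewrite /char_norm norm_polyM. Qed.

Lemma L_coef0 : L_coef 0 = 1.
Proof.
rewrite /L_coef; have -> : monics F 0 = [:: 1].
  apply: perm_small_eq => //; apply: uniq_perm; rewrite ?monics_uniq // => u.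
  rewrite mem_monics inE; apply/andP/eqP => [[um su]|->]; last first.
    by rewrite monic1 size_poly1.
  have [c _ uE] := size_poly1P _ su; move: um; rewrite uE monicE lead_coefC => /eqP ->.
  by rewrite polyC1.
by rewrite big_seq1 /char_norm /norm_poly size_poly1 muln0 rmorph1 det1 mulr1 chi1.
Qed.

(** Write [u = w f + r]. By Cayley-Hamilton the norm of [u] depends only on [r] and on the degree,
    and each [r] occurs [q^(n - D - 1)] times. *)
Lemma L_coef_ge n : (D.+1 <= n)%N ->
  L_coef n = chi ((-1) ^+ (D.+1 * n)) * (q ^ (n - D.+1))%:R
             * \sum_(r <- low_polys F D.+1) chi (\det (horner_mx M r)).
Proof.
move=> Dn; rewrite /L_coef (perm_big _ (perm_monics_div f_monic size_f Dn)) /=.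
rewrite big_allpairs_dep /=.
pose T := \sum_(r <- low_polys F D.+1) chi (\det (horner_mx M r)); rewrite -/T.
transitivity (\sum_(w <- monics F (n - D.+1)) (chi ((-1) ^+ (D.+1 * n)) * T)).
  rewrite big_seq [RHS]big_seq; apply: eq_bigr => w wn.
  rewrite mulr_sumr big_seq [RHS]big_seq; apply: eq_bigr => r rD.
  have sw : size (w * f + r) = n.+1.
    move: wn rD; rewrite mem_monics mem_low_polys => /andP[wm /eqP sw] rD.
    have swf : size (w * f) = n.+1.
      by rewrite size_Mmonic ?monic_neq0 // sw size_f addSn /= addnS subnK.
    by rewrite size_polyDl // swf ltnS (leq_trans rD Dn).
  rewrite /char_norm /norm_poly sw /= -chiM; congr (chi (_ * \det _)).
  by rewrite rmorphD rmorphM /= -charM Cayley_Hamilton mulr0 add0r.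
by rewrite big_const_seq count_predT iter_addr_0 size_monics -[LHS]mulr_natr mulrAC.
Qed.

(** This is the rationality of the L-series: multiplied by [1 - b t] with [b = chi((-1)^(D+1)) q],
    it becomes a polynomial. *)
Lemma L_coef_shift n : (D.+1 <= n)%N ->
  L_coef n.+1 = chi ((-1) ^+ D.+1) * q%:R * L_coef n.
Proof.
move=> Dn; rewrite !L_coef_ge ?leqW // subSn // expnS natrM mulnS exprD chiM.
by rewrite !mulrA; congr (_ * _); rewrite -!mulrA; congr (_ * _); rewrite mulrCA.
Qed.

Lemma sum_nat_of_bool (T : Type) (s : seq T) (P : pred T) :
  (\sum_(x <- s) P x)%N = count P s.
Proof.
by rewrite -sum1_count [RHS]big_mkcond; apply: eq_bigr => x _; case: (P x).
Qed.

(** After the sums are exchanged, each distinct root contributes its multiplicity, by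
    [count_orbit_poly]. *)
Lemma degree_count n u : u \in monics F n ->
  (\sum_(1 <= m < n.+1) \sum_(x <- frob_fixed F K m)
     (orbit_poly F m x %| map_poly emb u)%R)%N = n.
Proof.
rewrite mem_monics => /andP[um /eqP su].
have [rs ] := closed_field_poly_normal (map_poly emb u).
rewrite lead_coef_map (monicP um) rmorph1 scale1r => urs.
have srs : size rs = n.
  by apply: succn_inj; rewrite -su -(size_map_poly emb) urs size_prod_XsubC.
transitivity (\sum_(1 <= m < n.+1) \sum_(x <- undup rs)
     ((x ^+ (q ^ m) == x) && (orbit_poly F m x %| map_poly emb u)%R))%N.
  apply: eq_big_nat => m /andP[m0 _].
  rewrite !sum_nat_of_bool -!size_filter; apply: perm_size; apply: uniq_perm.
  - exact: filter_uniq (frob_fixed_uniq emb m0).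
  - exact: filter_uniq (undup_uniq _).
  move=> x; rewrite !mem_filter mem_frob_fixed // mem_undup -root_prod_XsubC -urs.
  case: eqP => [_|]; rewrite ?andbF ?andbT //=.
  case d: (_ %| _) => //=; apply/esym.
  by apply: root_dvdp d _; apply: root_orbit_poly.
rewrite exchange_big /= -[RHS]srs -sum1_size -[RHS]big_undup_iterop_count.
apply: eq_bigr => x _.
by rewrite -(count_orbit_poly x urs) srs Monoid.iteropE /= iter_addn mul1n addn0.
Qed.

(** This is the logarithmic derivative of the L-series, obtained without an Euler product: by
    [degree_count] the factor [n] counts the pairs [(m, x)] whose orbit polynomial divides [u], and
    then [u] is that polynomial times a monic cofactor. *)
Lemma newton n : n%:R * L_coef n = \sum_(1 <= m < n.+1) power_sum m * L_coef (n - m).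
Proof.
rewrite /L_coef mulr_sumr.
transitivity (\sum_(u <- monics F n) \sum_(1 <= m < n.+1) \sum_(x <- frob_fixed F K m)
    (if orbit_poly F m x %| map_poly emb u then char_norm u else 0)).
  rewrite big_seq [RHS]big_seq; apply: eq_bigr => u un.
  rewrite -[in LHS](degree_count un) natr_sum mulr_suml; apply: eq_bigr => m _.
  rewrite natr_sum mulr_suml; apply: eq_bigr => x _.
  by case: (_ %| _); rewrite ?mul1r ?mul0r.
rewrite exchange_big /=; apply: eq_big_nat => m /andP[m0 mn].
rewrite exchange_big /= /power_sum mulr_suml big_seq [RHS]big_seq.
apply: eq_bigr => x; rewrite mem_frob_fixed // => /eqP xm.
pose P := descend emb (orbit_poly F m x).
have PE : map_poly emb P = orbit_poly F m x by rewrite descendK // orbit_poly_frob.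
have Pm : P \is monic by rewrite -(map_monic emb) PE orbit_poly_monic.
have sP : size P = m.+1 by rewrite -(size_map_poly emb) PE size_orbit_poly.
rewrite -big_mkcond -/P /=.
under eq_bigl => u do rewrite -PE dvdp_map.
rewrite -big_filter (perm_big _ (perm_monics_dvd Pm sP mn)) big_map mulr_sumr.
by rewrite big_seq [RHS]big_seq; apply: eq_bigr => w; rewrite mem_monics => /andP[wm _]; apply: char_normM.
Qed.

Lemma norm_orbit_poly m x : x \in frob_fixed F K m -> (0 < m)%N ->
  emb (norm_poly M (descend emb (orbit_poly F m x)))
  = \prod_(i < m) (map_poly emb f).[x] ^+ (q ^ i).
Proof.
move=> xm m0; move: xm; rewrite mem_frob_fixed // => /eqP xm.
rewrite (norm_poly_roots charM (rs := frob_orbit F m x)); last first.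
  by rewrite descendK ?orbit_poly_frob // orbit_polyE.
rewrite big_map -[m in iota 0 m]subn0 big_mkord; apply: eq_bigr => i _.
elim: (i : nat) => [|j IH]; first by rewrite !expn0 !expr1.
rewrite expnSr !exprM -/(frob emb _) -/(frob emb _) -IH.
have {1}-> : map_poly emb f = map_poly (frob emb) (map_poly emb f).
  by rewrite -map_poly_comp; apply: eq_map_poly => a /=; rewrite frob_emb.
by rewrite horner_map.
Qed.

End LFunction.

(** * Power sums *)


Section TruncatedSeries.

Variables (R : comNzRingType) (T : nat).
Implicit Types p A B P Q : {poly R}.

Definition eqX p Q := forall n, (n < T)%N -> p`_n = Q`_n.

Lemma eqX_mul A B P Q : eqX A B -> eqX P Q -> eqX (A * P) (B * Q).
Proof.
move=> AB PQ n nT; rewrite !coefM; apply: eq_bigr => i _.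
by rewrite AB ?PQ // ?(leq_ltn_trans (leq_subr _ _)) // (leq_trans (ltn_ord i)).
Qed.

Lemma eqX_cancel A P Q : A`_0 = 1 -> eqX (A * P) (A * Q) -> eqX P Q.
Proof.
move=> A0 E n; elim/ltn_ind: n => n IH nT; have := E n nT.
rewrite !coefM !big_ord_recl A0 !mul1r subn0.
set u := \sum_(i < n) _; set v := \sum_(i < n) _.
have -> : u = v; last by move/addIr.
by apply: eq_bigr => i _; congr (_ * _); apply: IH; rewrite /= /bump /=; have := ltn_ord i; lia.
Qed.

(** This says that [P] is [- X A' / A] modulo [X^T], stated without division. *)
Definition log_deriv A P := eqX (A * P) (- ('X * A^`())).

Lemma coef_Xderiv A n : ('X * A^`())`_n = A`_n *+ n.
Proof. by rewrite coefXM coef_deriv; case: n. Qed.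

Lemma eqX_Xderiv A B : eqX A B -> eqX (- ('X * A^`())) (- ('X * B^`())).
Proof. by move=> AB n nT; rewrite !coefN !coef_Xderiv AB. Qed.

Lemma log_deriv_mul A B P Q :
  log_deriv A P -> log_deriv B Q -> log_deriv (A * B) (P + Q).
Proof.
move=> AP BQ; rewrite /log_deriv derivM.
have -> : A * B * (P + Q) = A * P * B + A * (B * Q) by ring.
have -> : - ('X * (A^`() * B + A * B^`())) = - ('X * A^`()) * B + A * - ('X * B^`()) by ring.
by move=> n nT; rewrite !coefD (eqX_mul AP (Q := B)) // (eqX_mul (B := A) _ BQ).
Qed.

(** The truncation of [b X / (1 - b X)]. *)
Definition geom (b : R) : {poly R} := \poly_(i < T) (if i == 0%N then 0 else b ^+ i).

Lemma log_deriv_geom b : log_deriv (1 - b *: 'X) (geom b).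
Proof.
move=> n nT; rewrite coefN coef_Xderiv mulrBl mul1r -scalerAl !coefB.
rewrite coef1 !coefZ coefXM coefX !coef_poly nT.
case: n nT => [|[|n]] nT /=; rewrite ?mulr0 ?mulr0n ?subr0 ?mulr1 ?sub0r ?oppr0 //.
  by rewrite ltnW // mulr0 subr0 mulr1n opprK.
by rewrite (ltnW nT) -exprS subrr mul0rn oppr0.
Qed.

Lemma log_deriv_prod (s : seq R) :
  log_deriv (\prod_(w <- s) (1 - w *: 'X)) (\sum_(w <- s) geom w).
Proof.
elim: s => [|w s IH]; last first.
  by rewrite !big_cons; apply: log_deriv_mul => //; apply: log_deriv_geom.
by move=> n _; rewrite !big_nil derivC !mulr0 oppr0.
Qed.

End TruncatedSeries.

Lemma reciprocal_factorization (K : closedFieldType) (p : {poly K}) :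
  p`_0 = 1 -> exists2 s : seq K, (size s < size p)%N & p = \prod_(w <- s) (1 - w *: 'X).
Proof.
move=> p0; have [rs pE] := closed_field_poly_normal p.
have pn0 : p != 0 by apply/eqP => E; move: p0; rewrite E coef0 => /esym/eqP; rewrite oner_eq0.
have rs0 z : z \in rs -> z != 0.
  move=> zrs; apply: contra_eq_neq p0 => z0.
  rewrite -horner_coef0 pE hornerZ -z0 (_ : _.[_] = 0) ?mulr0 1?eq_sym ?oner_eq0 //.
  by apply/eqP; rewrite -rootE root_prod_XsubC.
exists [seq z^-1 | z <- rs].
  by rewrite size_map pE size_scale ?lead_coef_eq0 // size_prod_XsubC.
have E : p = (lead_coef p * \prod_(z <- rs) - z) *: \prod_(w <- [seq z^-1 | z <- rs]) (1 - w *: 'X).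
  rewrite {1}pE -scalerA big_map -scaler_prod; congr (_ *: _).
  apply: eq_big_seq => z zrs; rewrite scalerBr scalerA mulNr divff ?rs0 //.
  by rewrite scaleN1r opprK addrC -[- z *: 1]/((- z)%:A) alg_polyC polyCN.
have c1 : lead_coef p * \prod_(z <- rs) - z = 1.
  have := congr1 (horner^~ 0) E; rewrite /= horner_coef0 p0 hornerZ horner_prod.
  rewrite [X in _ = _ * X]big1 ?mulr1 // => w _.
  by rewrite hornerD hornerN hornerZ hornerX hornerC mulr0 subr0.
by rewrite {1}E c1 scale1r.
Qed.

(* The generating series of c is N(t) / (1 - b t) with N of degree at most d, and s
   lists the inverses of the roots of N. *)
Lemma power_sums_of_recursion (K : closedFieldType) (c S : nat -> K) (b : K) d :
  c 0%N = 1 -> (forall n, (d <= n)%N -> c n.+1 = b * c n) ->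
  (forall n, n%:R * c n = \sum_(1 <= m < n.+1) S m * c (n - m)%N) ->
  exists2 s : seq K, (size s <= d)%N &
    forall m, (0 < m)%N -> S m = b ^+ m - \sum_(w <- s) w ^+ m.
Proof.
move=> c0 cd cS.
(* These are the coefficients of [1 - b X] times the generating series of [c]; they vanish beyond
   [d], so [N] is the whole product. *)
pose e n := if n is n'.+1 then c n'.+1 - b * c n' else 1.
pose N : {poly K} := \poly_(i < d.+1) e i.
have N0 : N`_0 = 1 by rewrite coef_poly.
have [s sN NE] := reciprocal_factorization N0.
exists s; first by rewrite -ltnS; apply: leq_trans sN (size_poly _ _).
(* The list [s] is fixed before [m]; truncation just past [m] suffices to read off the coefficient
   of [X^m]. *)
move=> m m0; pose T := m.+1.
pose C : {poly K} := \poly_(i < T) c i.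
pose Sg : {poly K} := \poly_(i < T) (if i == 0%N then 0 else S i).
have CN : eqX T ((1 - b *: 'X) * C) N.
  move=> n nT; rewrite mulrBl mul1r -scalerAl coefB coefZ coefXM !coef_poly nT.
  case: n nT => [|n] nT /=; first by rewrite mulr0 subr0 c0.
  by rewrite (ltnW nT) ltnS; case: ltnP => // dn; rewrite cd // subrr.
have CS : log_deriv T C (- Sg).
  move=> n nT; rewrite mulrN !coefN coef_Xderiv coefM; congr (- _).
  rewrite coef_poly nT -mulr_natl cS big_add1 /= big_mkord big_ord_recr /= subnn.
  rewrite [Sg`_0]coef_poly /= mulr0 addr0 (reindex_inj rev_ord_inj) /=.
  apply: eq_bigr => i _; rewrite !coef_poly.
  have := ltn_ord i => i_n; rewrite (leq_ltn_trans (leq_subr _ _) nT).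
  rewrite (leq_ltn_trans (leq_subr _ _) nT) mulrC.
  by have -> : (n - (n - i.+1) = i.+1)%N by lia.
have := log_deriv_mul (@log_deriv_geom K T b) CS.
move=> H; have H2 : eqX T (N * (geom T b - Sg)) (- ('X * N^`())).
  move=> n nT; rewrite -(eqX_Xderiv CN) // -H //.
  by rewrite (eqX_mul (fun k kT => esym (CN k kT)) (Q := geom T b - Sg)).
(* Both sides are the logarithmic derivative of [N], once from its expression by [C] and once from
   its factorization. *)
have H3 : eqX T (geom T b - Sg) (\sum_(w <- s) geom T w).
  apply: (@eqX_cancel _ _ N) => // n nT; rewrite H2 // {1 2}NE.
  by rewrite -(@log_deriv_prod K T s).
have := H3 m (ltnSn m); rewrite coefB coef_sum !coef_poly ltnSn gtn_eqF //.
under eq_bigr => w _ do rewrite coef_poly ltnSn gtn_eqF //.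
by move=> <-; ring.
Qed.


(** * From growth of power sums to the size of their terms *)

Lemma bernoulli_ineq (R : numDomainType) (x : R) m :
  0 <= x -> 1 + m%:R * x <= (1 + x) ^+ m.
Proof.
move=> x0; elim: m => [|m IH]; first by rewrite mul0r addr0.
apply: le_trans (_ : (1 + x) * (1 + m%:R * x) <= _).
  have -> : (1 + x) * (1 + m%:R * x) = 1 + m.+1%:R * x + m%:R * x ^+ 2.
    by rewrite -natr1; ring.
  by rewrite lerDl mulr_ge0 // exprn_ge0.
by rewrite exprS ler_wpM2l // addr_ge0.
Qed.

(** If [z > B], Bernoulli's inequality makes [(z / B) ^+ m] exceed [C] for large [m]. *)
Lemma geometric_growth (z B C : algC) m0 : 0 <= z -> 0 < B -> 0 <= C ->
  (forall m, (m0 <= m)%N -> z ^+ m <= C * B ^+ m) -> z <= B.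
Proof.
move=> z0 B0 C0 H.
have [//|Bz] := real_leP (ger0_real z0) (gtr0_real B0).
pose x := z / B - 1.
have x0 : 0 < x by rewrite subr_gt0 ltr_pdivlMr // mul1r.
pose m := (m0 + Num.bound (C / x))%N.
have h1 : (z / B) ^+ m <= C.
  by rewrite expr_div_n ler_pdivrMr ?exprn_gt0 //; apply: H; apply: leq_addr.
have h2 : 1 + m%:R * x <= C.
  have zx : z / B = 1 + x by rewrite /x addrC subrK.
  by apply: le_trans h1; rewrite zx; apply: bernoulli_ineq; apply: ltW.
have h3 : C < m%:R * x.
  rewrite -ltr_pdivrMr //; apply: lt_le_trans (archi_boundP _) _.
    by rewrite divr_ge0 // ltW.
  by rewrite ler_nat leq_addl.
have : 1 + C < C by apply: lt_le_trans h2; rewrite ltrD2l.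
by rewrite gtrDr ltr10.
Qed.

(** Group equal terms. Each value that survives with nonzero multiplicity can be isolated by a
    linear combination of shifted power sums, so its powers are [O(B^m)] and it has modulus at most
    [B]. The multiplicities add up to at most [size s + 1] in absolute value. *)
Lemma power_sum_bound (b : algC) (s : seq algC) (C B : algC) m0 : 0 < B -> 0 <= C ->
  (forall m, (m0 <= m)%N -> `|b ^+ m - \sum_(w <- s) w ^+ m| <= C * B ^+ m) ->
  `|b - \sum_(w <- s) w| <= (size s).+1%:R * B.
Proof.
move=> B0 C0 H; pose V := undup (b :: s).
(* Signed multiplicity: [b] may cancel against an entry of [s]; such a value gets no bound but
   contributes nothing. *)
pose n z : algC := (z == b)%:R - (count_mem z s)%:R.
have single (g : algC -> algC) w : w \in V -> \sum_(z <- V) (w == z)%:R * g z = g w.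
  move=> wV; rewrite (bigD1_seq w) ?undup_uniq //= eqxx mul1r big1 ?addr0 // => z.
  by rewrite eq_sym => /negPf ->; rewrite mul0r.
have nE (g : algC -> algC) : g b - \sum_(w <- s) g w = \sum_(z <- V) n z * g z.
  rewrite -(single g b) ?mem_undup ?mem_head //.
  have -> : \sum_(w <- s) g w = \sum_(w <- s) \sum_(z <- V) (w == z)%:R * g z.
    apply: eq_big_seq => w ws; rewrite single // mem_undup inE ws orbT //.
  rewrite exchange_big /= -sumrB; apply: eq_bigr => z _.
  rewrite /n mulrBl [b == z]eq_sym; congr (_ - _); rewrite -mulr_suml; congr (_ * _).
  by rewrite -sum1_count natr_sum [RHS]big_mkcond; apply: eq_bigr => w _ /=; case: (w == z).
have small z0 : z0 \in V -> n z0 != 0 -> `|z0| <= B.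
  (* [P] vanishes at every value except [z0], so combining the sums of exponents [m + k] with its
     coefficients leaves [n z0 * P.[z0] * z0 ^+ m]. *)
  move=> z0V n0; pose P := \prod_(z <- rem z0 V) ('X - z%:P).
  have Vu : uniq V := undup_uniq _.
  have Pz0 : P.[z0] != 0.
    by rewrite -rootE root_prod_XsubC mem_rem_uniqF.
  pose c := `|n z0 * P.[z0]|.
  have c0 : 0 < c by rewrite normr_gt0 mulf_neq0.
  pose C' := (\sum_(k < size P) `|P`_k| * (C * B ^+ k)).
  apply: (@geometric_growth _ _ (C' / c) m0) => //.
    rewrite divr_ge0 ?(ltW c0) //; apply: sumr_ge0 => k _.
    by rewrite !mulr_ge0 // exprn_ge0 // ltW.
  move=> m mm0; rewrite mulrAC ler_pdivlMr // mulrC -normrX -normrM.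
  have -> : n z0 * P.[z0] * z0 ^+ m =
      \sum_(k < size P) P`_k * (b ^+ (m + k) - \sum_(w <- s) w ^+ (m + k)).
    under eq_bigr => k _ do rewrite (nE (fun z => z ^+ (m + k))) mulr_sumr.
    rewrite exchange_big /= (bigD1_seq z0) //= [X in _ + X]big1_seq ?addr0.
      rewrite horner_coef mulr_sumr mulr_suml; apply: eq_bigr => k _.
      by rewrite exprD; ring.
    move=> z /andP[zz0 zV].
    have : n z * z ^+ m * P.[z] = 0.
      rewrite (_ : P.[z] = 0) ?mulr0 //; apply/eqP; rewrite -rootE root_prod_XsubC.
      by rewrite mem_rem_uniq // inE zz0.
    move=> nzP; rewrite -[RHS]nzP horner_coef mulr_sumr; apply: eq_bigr => k _.
    by rewrite exprD; ring.
  rewrite mulr_suml; apply: le_trans (ler_norm_sum _ _ _) _; apply: ler_sum => k _.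
  rewrite normrM -mulrA ler_wpM2l // -mulrA -exprD addnC.
  by rewrite addnC; apply: H; apply: leq_trans mm0 _; rewrite leq_addr.
rewrite (nE id); apply: le_trans (ler_norm_sum _ _ _) _.
apply: le_trans (_ : \sum_(z <- V) ((z == b)%:R + (count_mem z s)%:R) * B <= _).
  rewrite big_seq [leRHS]big_seq; apply: ler_sum => z zV; rewrite normrM.
  have [->|nz] := eqVneq (n z) 0.
    by rewrite normr0 mul0r mulr_ge0 // ?(ltW B0) // addr_ge0.
  apply: ler_pM => //; last exact: small.
  by apply: le_trans (ler_normB _ _) _; rewrite !normr_nat.
rewrite -mulr_suml ler_wpM2r ?(ltW B0) // big_split /= -!natr_sum -natrD ler_nat.
have h1 : (\sum_(z <- V) (z == b) = 1)%N.
  rewrite (bigD1_seq b) ?undup_uniq ?mem_undup ?mem_head //= eqxx big1 // => z.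
  by move/negPf->.
have h2 : (\sum_(z <- V) count_mem z s = size s)%N.
  under eq_bigr => z _ do rewrite -sum1_count big_mkcond.
  rewrite exchange_big /= -sum1_size; apply: eq_big_seq => w ws.
  rewrite (bigD1_seq w) ?undup_uniq ?mem_undup ?inE ?ws ?orbT //= eqxx big1 // => z.
  by rewrite eq_sym => /negPf->.
by rewrite h1 h2 add1n.
Qed.

(** * The Weil bound *)


Section Lift.

Variables (F : finFieldType) (K : closedFieldType) (emb : {rmorphism F -> K}).
Variable f : {poly F}.
Let q := #|F|.

(** A monic [r]-th root of [f] over [K] is unique, hence fixed by Frobenius, hence defined over
    [F]. *)
Lemma power_free_map d : f \is monic -> power_free d f -> power_free d (map_poly emb f).
Proof.
move=> fm pf r b r1 rd; apply/negP => E.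
have b0 : b != 0.
  apply/eqP => b0; move: E; rewrite b0 expr0n gtn_eqF ?(ltnW r1) //.
  by rewrite eqp0 map_poly_eq0 (negPf (monic_neq0 fm)).
pose b1 := (lead_coef b)^-1 *: b.
have b1m : b1 \is monic by rewrite monicE lead_coefZ mulVf // lead_coef_eq0.
have fb : map_poly emb f = b1 ^+ r.
  apply/eqP; rewrite -eqp_monic ?map_monic ?monic_exp //.
  apply: eqp_trans E _; apply: eqp_exp; rewrite eqp_sym eqp_scale //.
  by rewrite invr_eq0 lead_coef_eq0.
have b1f : map_poly (frob emb) b1 = b1.
  apply/eqP; rewrite -eqp_monic ?map_monic // -(@eqp_exp2r _ _ _ r) ?(ltnW r1) //.
  rewrite -rmorphXn /= -fb -map_poly_comp.
  rewrite (eq_map_poly (g := emb)) ?eqpxx // => a /=; exact: frob_emb.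
have := pf r (descend emb b1) r1 rd; rewrite -(eqp_map emb) rmorphXn /=.
by rewrite descendK // fb eqpxx.
Qed.

Lemma map_poly_expq t :
  map_poly emb f \Po 'X^(q ^ t) = map_poly emb f ^+ (q ^ t).
Proof.
have fixc a : emb a ^+ (q ^ t) = emb a.
  elim: t => [|t IH]; first by rewrite expr1.
  by rewrite expnSr exprM IH -/(frob emb _) frob_emb.
rewrite -[in RHS](coefK (map_poly emb f)) poly_def expr_sum_pchar; last first.
  by apply: sub_in_pnat (card_pchar emb t) => p _; rewrite pchar_poly.
rewrite comp_polyE; apply: eq_bigr => i _.
by rewrite exprZn !coef_map fixc -!exprM mulnC.
Qed.

End Lift.

Section Weil.

Variables (F : finFieldType) (chi : F -> algC) (D : nat) (f : {poly F}).
Hypotheses (chi0 : chi 0 = 0) (chi1 : chi 1 = 1).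
Hypothesis chiM : {morph chi : x y / x * y}.
Hypothesis chi_nontrivial : exists2 x, x != 0 & chi x != 1.
Hypotheses (f_monic : f \is monic) (size_f : size f = D.+2).
Hypothesis f_power_free : power_free #|F|.-1 f.
Let q := #|F|.

Lemma norm_char a : a != 0 -> `|chi a| = 1.
Proof.
move=> a0; have q1 := card_gt1 F.
have E : chi a ^+ q.-1 = 1.
  have chiX n : chi a ^+ n = chi (a ^+ n).
    by elim: n => [|n IH]; rewrite ?expr0 ?chi1 // !exprS chiM IH.
  rewrite chiX -chi1; congr chi; apply: (mulIf a0); rewrite mul1r -exprSr.
  by rewrite prednK ?expf_card // ltnW.
apply/eqP; rewrite -(@pexpr_eq1 _ _ q.-1) //; last by rewrite /q; lia.
by rewrite -normrX E normr1.
Qed.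

Lemma sum_char : \sum_a chi a = 0.
Proof.
have [x x0 cx] := chi_nontrivial.
have E : \sum_a chi a = chi x * \sum_a chi a.
  rewrite mulr_sumr [LHS](reindex_inj (mulfI x0)).
  by apply: eq_bigr => a _; rewrite chiM.
apply/eqP; move/eqP: E; rewrite -subr_eq0 -{1}[X in X - _]mul1r -mulrBl mulf_eq0.
by rewrite subr_eq0 eq_sym (negPf cx).
Qed.

Variables (K : closedFieldType) (emb : {rmorphism F -> K}) (M : 'M[F]_D.+1).
Hypothesis charM : char_poly M = f.

(** The norm of [f(x)] from the field with [q^m] elements, that is, its power of exponent
    [nu m = (q^m - 1) / (q - 1)]; see [emb_norm_value]. *)
Let y (m : nat) (x : K) : F := norm_poly M (descend emb (orbit_poly F m x)).
Let nu m := (\sum_(i < m) q ^ i)%N.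

Lemma expq_nu m : (q ^ m = (q.-1 * nu m).+1)%N.
Proof.
rewrite -[LHS]prednK ?expn_gt0 ?(ltnW (card_gt1 F)) //.
by rewrite predn_exp.
Qed.

Lemma nuD t t' : (nu t * q ^ t' + nu t' = nu (t + t'))%N.
Proof.
rewrite [in RHS]addnC [RHS]/nu big_split_ord /= addnC; congr (_ + _)%N.
rewrite /nu big_distrl /=.
by apply: eq_bigr => i _; rewrite expnD mulnC.
Qed.

Lemma emb_norm_value m x : (0 < m)%N -> x \in frob_fixed F K m ->
  emb (y m x) = (map_poly emb f).[x] ^+ nu m.
Proof. by move=> m0 xm; rewrite (norm_orbit_poly emb charM) // expr_sum. Qed.

Lemma power_sum_fibers m :
  power_sum emb M chi m = \sum_a chi a * (count (fun x => y m x == a) (frob_fixed F K m))%:R.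
Proof.
rewrite /power_sum.
under [RHS]eq_bigr => a _ do rewrite -sum1_count natr_sum mulr_sumr.
under [RHS]eq_bigr => a _ do rewrite big_mkcond.
rewrite exchange_big /=; apply: eq_bigr => x _.
rewrite -big_mkcond /= (eq_bigl (pred1 (y m x))) => [|a]; last by rewrite /= eq_sym.
by rewrite big_pred1_eq mulr1.
Qed.

(** Stepanov's bound with [s = q^t], [s' = q^t'], [d = q - 1], [n = nu t], [n' = nu t'], where [t]
    and [t'] are the lower and upper halves of [m]; by [nuD] the exponent [n s' + n'] is [nu m]. *)
Lemma fiber_bound m a : a != 0 -> (2 * (D.+1 + 2 * D.+1 ^ 2) <= m)%N ->
  (count (fun x => y m x == a) (frob_fixed F K m)
   <= nu m + (2 * D.+1 + 1) * q ^ (uphalf m))%N.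
Proof.
move=> a0 m_large; have m0 : (0 < m)%N by lia.
have q1 := card_gt1 F.
pose t := m./2; pose t' := uphalf m.
have mE : m = (t + t')%N by rewrite /t /t'; lia.
(* A nontrivial character rules out the field with two elements. *)
have q2 : (1 < q.-1)%N.
  have [x x0 cx] := chi_nontrivial.
  rewrite ltnNge; apply: contra cx => q2.
  have qE : q.-1 = 1%N by move: q1 q2; rewrite /q; lia.
  have : x ^+ q.-1 = 1.
    by apply: (mulIf x0); rewrite mul1r -exprSr prednK ?expf_card // ltnW.
  by rewrite qE expr1 => ->; rewrite chi1.
have leD i : (i <= nu i)%N.
  rewrite -{1}[i]card_ord -sum1_card; apply: leq_sum => j _.
  by rewrite expn_gt0 ltnW.
have monn i j : (i <= j)%N -> (nu i <= nu j)%N.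
  by move=> ij; rewrite /nu (big_ord_widen_cond j xpredT) // [X in (X <= _)%N]big_mkcond; apply: leq_sum => k _; case: ifP.
rewrite -size_filter.
apply: leq_trans (_ : nu t * q ^ t' + (2 * D.+1 + 1) * q ^ t' <= _)%N; last first.
  by rewrite leq_add2r mE -nuD leq_addr.
apply: (@stepanov_bound K (q ^ t) (q ^ t') q.-1 (nu t) (nu t') D.+1 (map_poly emb f)
   (card_pchar emb t) (expq_nu t) (expq_nu t') _ q2 _ _ (map_poly_expq emb f t') _ (emb a)).
- by apply: monn; rewrite /t /t'; lia.
- by apply: leq_trans (leD _); rewrite /t'; lia.
- by rewrite size_map_poly.
- exact: power_free_map.
- by rewrite filter_uniq // frob_fixed_uniq.
move=> x; rewrite mem_filter => /andP[/eqP yx xm]; split.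
- by rewrite -expnD -mE; apply/eqP; rewrite -mem_frob_fixed.
- by rewrite nuD -mE -emb_norm_value ?yx.
apply: contra a0 => /eqP fx; have := emb_norm_value m0 xm; rewrite fx yx.
by rewrite expr0n gtn_eqF ?(leq_trans m0) // => /eqP; rewrite fmorph_eq0.
Qed.

(* Each fiber has at most nu m + O(q^(uphalf m)) elements; as the fibers partition
   q^m points and the values of chi sum to zero, the upper bounds suffice. *)
Lemma power_sum_upper m : (2 * (D.+1 + 2 * D.+1 ^ 2) <= m)%N ->
  `|power_sum emb M chi m|
    <= (q.-1 * ((2 * D.+1 + 1) * q ^ (uphalf m)) + D.+1)%:R.
Proof.
move=> m_large; have m0 : (0 < m)%N by lia.
pose N a := count (fun x => y m x == a) (frob_fixed F K m).
pose B := (nu m + (2 * D.+1 + 1) * q ^ (uphalf m))%N.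
have NB a : a != 0 -> (N a <= B)%N by move=> a0; apply: fiber_bound.
have N0 : (N 0%R <= D.+1)%N.
  rewrite /N -size_filter -ltnS -size_f -(size_map_poly emb).
  apply: max_poly_roots; first by rewrite map_poly_eq0 monic_neq0.
    apply/allP => x; rewrite mem_filter => /andP[/eqP yx xm].
    by have := emb_norm_value m0 xm; rewrite yx rmorph0 => /esym/eqP; rewrite expf_eq0 => /andP[].
  by rewrite filter_uniq // frob_fixed_uniq.
have Nsum : (\sum_a N a = q ^ m)%N.
  rewrite -(size_frob_fixed F K m0) -sum1_size.
  under eq_bigr => a _ do rewrite /N -sum1_count big_mkcond.
  rewrite exchange_big /=; apply: eq_bigr => x _.
  by rewrite -big_mkcond /= (eq_bigl (pred1 (y m x))) ?big_pred1_eq // => a; rewrite /= eq_sym.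
rewrite power_sum_fibers.
have -> : \sum_a chi a * (N a)%:R = - \sum_(a | a != 0) chi a * (B - N a)%:R.
  have -> : \sum_a chi a * (N a)%:R = \sum_a chi a * (N a)%:R - B%:R * \sum_a chi a.
    by rewrite sum_char mulr0 subr0.
  rewrite mulr_sumr -sumrB (bigD1 0) //= chi0 !mul0r mulr0 subr0 add0r -sumrN.
  by apply: eq_bigr => a a0; rewrite natrB ?NB //; ring.
rewrite normrN; apply: le_trans (ler_norm_sum _ _ _) _.
apply: le_trans (_ : \sum_(a | a != 0) (B - N a)%:R <= _).
  by apply: ler_sum => a a0; rewrite normrM norm_char // mul1r normr_nat.
rewrite -natr_sum ler_nat -(leq_add2r (\sum_(a | a != 0) N a)) -big_split /=.
under eq_bigr => a a0 do rewrite subnK ?NB //.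
have h : (\sum_(a | a != 0%R) N a = q ^ m - N 0%R)%N.
  by rewrite -Nsum [in RHS](bigD1 0) //= addKn.
have N0q : (N 0%R <= q ^ m)%N by rewrite -Nsum (bigD1 0) //= leq_addr.
rewrite sum_nat_const h.
have -> : #|(fun a : F => a != 0)| = q.-1 by rewrite -(cardC1 (0 : F)); apply: eq_card.
(* The main terms cancel since [(q - 1) nu m = q^m - 1]; what remains is the error and the fiber
   over 0. *)
have := expq_nu m; rewrite /B mulnDr; move: (q.-1 * nu m)%N (_ * (_ * _))%N => u v; lia.
Qed.

End Weil.

(** The sum is the first power sum. The L-series yields at most [D] inverse roots and [b] adds one
    more term, whence the factor [D + 1] once all power sums are bounded by a constant times
    [sqrt(q)^m]. *)
Theorem weil_bound (F : finFieldType) (chi : F -> algC) (D : nat) (f : {poly F}) :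
  chi 0 = 0 -> chi 1 = 1 -> {morph chi : x y / x * y} ->
  (exists2 x, x != 0 & chi x != 1) ->
  f \is monic -> size f = D.+1 -> (0 < D)%N -> power_free #|F|.-1 f ->
  `|\sum_x chi f.[x]| <= D.+1%:R * sqrtC #|F|%:R.
Proof.
move=> chi0 chi1 chiM chi_nt fm; case: D => // D sf _ pf.
have [K [emb _]] := countable_algebraic_closure F.
have [M charM] := companion_exists fm sf.
have q1 := card_gt1 F; set q := #|F| in q1 *.
have sq0 : 0 < sqrtC q%:R :> algC by rewrite sqrtC_gt0 ltr0n ltnW.
have [s ss sE] := power_sums_of_recursion (L_coef0 M chi1)
   (L_coef_shift charM chiM) (newton emb M chiM).
set b := chi _ * _ in sE.
have -> : \sum_x chi f.[x] = power_sum emb M chi 1.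
  have perm1 : perm_eq (frob_fixed F K 1) [seq emb x | x <- enum F].
    apply: uniq_perm; first exact: frob_fixed_uniq.
      by rewrite map_inj_uniq ?enum_uniq //; apply: fmorph_inj.
    move=> x; rewrite mem_frob_fixed // expn1; apply/eqP/mapP => [xq|[a _ ->]].
      by exists (emb_inv emb x); rewrite ?mem_enum // emb_invK.
    exact: frob_emb.
  rewrite /power_sum (perm_big _ perm1) big_map big_enum /=; apply: eq_bigr => x _.
  rewrite /char_norm; congr chi; apply: (fmorph_inj emb).
  rewrite (norm_orbit_poly emb charM) // ?(perm_mem perm1) ?map_f ?mem_enum //.
  by rewrite big_ord1 expn0 expr1 horner_map.
rewrite sE // expr1; under eq_bigr => w _ do rewrite expr1.
apply: le_trans (_ : (size s).+1%:R * sqrtC q%:R <= _); last first.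
  by rewrite ler_wpM2r ?(ltW sq0) // ler_nat ltnS.
(* The extra factor [sqrt q] absorbs the rounding in [q ^ uphalf m <= sqrt(q)^(m + 1)]. *)
pose C : algC := (q.-1 * (2 * D.+1 + 1) + D.+1)%:R * sqrtC q%:R.
apply: (@power_sum_bound _ _ C _ (2 * (D.+1 + 2 * D.+1 ^ 2))) => //.
  by rewrite mulr_ge0 // ltW.
move=> m m_large; rewrite -sE; last by lia.
apply: le_trans (power_sum_upper chi0 chi1 chiM chi_nt fm sf pf emb charM m_large) _.
rewrite /C -mulrA -exprS.
apply: le_trans (_ : ((q.-1 * (2 * D.+1 + 1) + D.+1) * q ^ uphalf m)%:R <= _).
  by rewrite ler_nat [X in (_ <= X)%N]mulnDl leq_add ?mulnA // leq_pmulr // expn_gt0 ltnW.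
rewrite natrM ler_wpM2l // natrX -[q%:R in X in X <= _]sqrtCK -exprM.
rewrite ler_weXn2l // ?uphalf_half; last by lia.
by rewrite -[X in X <= _]sqrtC1 ler_sqrtC ?ler1n ?qualifE /= ?ler0n ?ler01 // ltnW.
Qed.

(** * Products hitting a value set *)


Lemma triple_sum (R : comNzRingType) (I J L : finType) (A : {set I}) (B : {set J})
    (c : R) (u : I -> R) (v : J -> R) (w : L -> R) :
  c * (\sum_(a in A) u a) * (\sum_(b in B) v b) * (\sum_x w x)
  = \sum_(a in A) \sum_(b in B) \sum_x c * u a * v b * w x.
Proof.
rewrite [c * _]mulr_sumr !mulr_suml; apply: eq_bigr => a _.
rewrite [X in X * _ = _]mulr_sumr mulr_suml; apply: eq_bigr => b _.
by rewrite mulr_sumr.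
Qed.

Section Characters.

Variables (F : finFieldType) (z : F) (eps : algC).
Let N := #|F|.-1.
Hypotheses (z_prim : N.-primitive_root z) (eps_prim : N.-primitive_root eps).

Definition dlog (x : F) : nat :=
  if [pick i : 'I_(#|F|.-1) | z ^+ i == x] is Some i then i else 0%N.

Lemma unit_pow (x : F) : x != 0 -> x ^+ N = 1.
Proof.
move=> x0; apply: (mulIf x0).
by rewrite mul1r -exprSr prednK ?expf_card // ltnW // finNzRing_gt1.
Qed.

Lemma dlogK x : x != 0 -> z ^+ dlog x = x.
Proof.
move=> x0; rewrite /dlog; case: pickP => [i /eqP //|H].
have /(prim_rootP z_prim)[i xi] := unit_pow x0.
by have := H i; rewrite xi eqxx.
Qed.

Lemma generator_neq0 : z != 0.
Proof.
apply/eqP => z0; have /esym/eqP := prim_expr_order z_prim.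
by rewrite z0 expr0n gtn_eqF ?(prim_order_gt0 z_prim) // oner_eq0.
Qed.

Lemma dlog_expr i : dlog (z ^+ i) = i %[mod N].
Proof. by apply/eqP; rewrite -(eq_prim_root_expr z_prim) dlogK // expf_neq0 // generator_neq0. Qed.

Lemma dlogM x y : x != 0 -> y != 0 -> dlog (x * y) = (dlog x + dlog y)%N %[mod N].
Proof.
move=> x0 y0; apply/eqP; rewrite -(eq_prim_root_expr z_prim).
by rewrite exprD !dlogK // mulf_neq0.
Qed.

Definition chr (j : nat) (x : F) : algC := if x == 0 then 0 else eps ^+ (j * dlog x).

Lemma chr0 j : chr j 0 = 0. Proof. by rewrite /chr eqxx. Qed.

Lemma chr_expr j i : chr j (z ^+ i) = eps ^+ (j * i).
Proof.
rewrite /chr expf_eq0 (negPf generator_neq0) andbF; apply/eqP.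
by rewrite (eq_prim_root_expr eps_prim) -modnMmr dlog_expr modnMmr.
Qed.

Lemma chr1 j : chr j 1 = 1.
Proof. by rewrite -(expr0 z) chr_expr muln0 expr0. Qed.

Lemma chrM j : {morph chr j : x y / x * y}.
Proof.
move=> x y; have [->|x0] := eqVneq x 0; first by rewrite mul0r chr0 mul0r.
have [->|y0] := eqVneq y 0; first by rewrite mulr0 chr0 mulr0.
by rewrite -(dlogK x0) -(dlogK y0) -exprD !chr_expr mulnDr exprD.
Qed.

Lemma chrX j x n : chr j (x ^+ n) = chr j x ^+ n.
Proof. by elim: n => [|n IH]; rewrite ?expr0 ?chr1 // !exprS chrM IH. Qed.

Lemma norm_chr j x : x != 0 -> `|chr j x| = 1.
Proof.
move=> x0; have N0 := prim_order_gt0 eps_prim.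
apply/eqP; rewrite -(@pexpr_eq1 _ _ N) // -normrX -chrX unit_pow //.
by rewrite chr1 normr1.
Qed.

Lemma norm_chr_le j x : `|chr j x| <= 1.
Proof.
by have [->|x0] := eqVneq x 0; [rewrite chr0 normr0 | rewrite norm_chr].
Qed.

Lemma sum_chr x : x != 0 -> \sum_(j < N) chr j x = (if x == 1 then N%:R else 0).
Proof.
move=> x0; have [->|x1] := eqVneq x 1.
  by under eq_bigr => j _ do rewrite chr1; rewrite sumr_const card_ord.
have e1 : chr 1 x != 1.
  apply: contra x1; rewrite -{1}(dlogK x0) chr_expr mul1n -(expr0 eps).
  by rewrite (eq_prim_root_expr eps_prim) -(eq_prim_root_expr z_prim) expr0 dlogK.
have E j : chr j x = chr 1 x ^+ j.
  by rewrite -{1 2}(dlogK x0) !chr_expr mul1n -exprM mulnC.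
under eq_bigr => j _ do rewrite E.
apply/eqP; rewrite -(inj_eq (mulfI (_ : chr 1 x - 1 != 0))) ?subr_eq0 //.
by rewrite -subrX1 -chrX unit_pow // chr1 subrr mulr0.
Qed.

Lemma chrV j x : x != 0 -> chr j x^-1 = (chr j x)^*.
Proof.
move=> x0; have c0 : chr j x != 0 by rewrite -normr_gt0 norm_chr.
apply: (mulfI c0); rewrite -chrM divff // chr1 -normCK norm_chr //.
by rewrite expr1n.
Qed.

Section Energy.

Variable A : {set F}.
Hypothesis A0 : forall a, a \in A -> a != 0.

Definition inv_sum j := \sum_(a in A) chr j a^-1.

Lemma parseval : \sum_(j < N) `|inv_sum j| ^+ 2 = (N * #|A|)%:R.
Proof.
have E j : `|inv_sum j| ^+ 2 = \sum_(a in A) \sum_(b in A) chr j (a^-1 * b).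
  rewrite normCK /inv_sum rmorph_sum mulr_suml; apply: eq_bigr => a aA.
  rewrite mulr_sumr; apply: eq_bigr => b bA.
  by rewrite /= chrM -chrV ?invr_neq0 ?A0 // invrK.
under eq_bigr => j _ do rewrite E.
rewrite exchange_big /= natrM -sumr_const mulr_sumr; apply: eq_bigr => a aA.
rewrite exchange_big /= mulr1 (bigD1 a) //= sum_chr ?mulVf ?oner_neq0 ?A0 // eqxx.
rewrite big1 ?addr0 // => b /andP[bA ba].
rewrite sum_chr ?mulf_neq0 ?invr_neq0 ?A0 //; case: eqP => // E1.
by case/eqP: ba; rewrite -[LHS](mulVKf (A0 aA)) E1 mulr1.
Qed.

End Energy.

Section Hits.

Variables (D l n : nat) (h f : {poly F}) (C c : F) (A B : {set F}).
Hypotheses (size_h : size h = D.+1) (D0 : (0 < D)%N) (l0 : (0 < l)%N).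
Hypotheses (hE : h = C *: f ^+ l) (C0 : C != 0) (c0 : c != 0).
Hypothesis f_pf : forall r b, (1 < r)%N -> ~~ (f %= b ^+ r).
Hypothesis nE : n = gcdn l N.
Hypotheses (A0 : forall a, a \in A -> a != 0) (B0 : forall b, b \in B -> b != 0).
Hypothesis class_eq : forall a b, a \in A -> b \in B ->
  dlog c + dlog a + dlog b = dlog C %[mod n].

Let T j := \sum_x chr j h.[x].

(** The exponent [l] is moved into the character: [x -> chr j (x ^+ l)] is nontrivial exactly when
    [N] does not divide [j l], equivalently [j n]. The Weil bound is then applied to [f] made monic,
    which is not a power. *)
Lemma sum_value_bound j : ~~ (N %| j * n)%N -> `|T j| <= D.+1%:R * sqrtC #|F|%:R.
Proof.
move=> jn.
have f0 : f != 0.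
  apply/eqP => f00; move: size_h.
  by rewrite hE f00 expr0n gtn_eqF // scaler0 size_poly0.
have fn : size f != 1%N.
  apply/negP => /size_poly1P[k k0 fk]; move: size_h.
  rewrite hE fk -polyC_exp -mul_polyC -polyCM size_polyC mulf_neq0 ?expf_neq0 //.
  by case: D D0.
pose f1 := (lead_coef f)^-1 *: f.
have lf0 : lead_coef f != 0 by rewrite lead_coef_eq0.
have f1m : f1 \is monic by rewrite monicE lead_coefZ mulVf.
have sf1 : size f1 = size f by rewrite size_scale // invr_eq0.
have [d sd] : exists d, size f = d.+2.
  by move: f0 fn; rewrite -size_poly_gt0; case: (size f) => [|[|d]] // _ _; exists d.
have dD : (d.+1 <= D)%N.
  have := congr1 predn size_h; rewrite hE size_scale // size_exp sd /= => <-.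
  by rewrite leq_pmulr.
pose chi x := chr j (x ^+ l).
have TE : T j = chr j (C * lead_coef f ^+ l) * \sum_x chi f1.[x].
  rewrite mulr_sumr; apply: eq_bigr => x _; rewrite -chrM; congr chr.
  rewrite hE hornerZ horner_exp /f1 hornerZ -mulrA -exprMn mulrA divff //.
  by rewrite mul1r.
have chi_bound : `|\sum_x chi f1.[x]| <= d.+2%:R * sqrtC #|F|%:R.
  apply: weil_bound => //.
  - by rewrite /chi expr0n gtn_eqF // chr0.
  - by rewrite /chi expr1n chr1.
  - by move=> x y; rewrite /chi exprMn chrM.
  - exists z; first exact: generator_neq0.
    rewrite /chi chr_expr -(prim_order_dvd eps_prim); apply: contra jn => jl.
    by rewrite nE muln_gcdr dvdn_gcd jl dvdn_mull.
  - by rewrite sf1.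
  - move=> r b r1 _; rewrite (eqp_ltrans (eqp_scale _ _)) ?invr_eq0 //.
    exact: f_pf.
rewrite TE normrM -[leRHS]mul1r ler_pM ?norm_chr_le //.
apply: le_trans chi_bound _; rewrite ler_wpM2r ?sqrtC_ge0 ?ler0n //.
by rewrite ler_nat ltnS.
Qed.

(* The characters with N %| j * n see only discrete logarithms modulo n. *)
Lemma chr_value j a b x : (N %| j * n)%N -> a \in A -> b \in B -> h.[x] != 0 ->
  chr j c^-1 * chr j a^-1 * chr j b^-1 * chr j h.[x] = 1.
Proof.
move=> jn aA bB hx; have := hx.
rewrite hE hornerZ mulf_eq0 negb_or C0 horner_exp expf_eq0 l0 /= => fx.
have e1 : eps ^+ (j * n) = 1.
  by apply/eqP; rewrite -(prim_order_dvd eps_prim).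
have modE i i' : i = i' %[mod n] -> eps ^+ (j * i) = eps ^+ (j * i').
  move=> E; rewrite (divn_eq i n) (divn_eq i' n) E !mulnDr !exprD.
  have red k : eps ^+ (j * (k * n)) = 1 by rewrite mulnCA mulnC exprM e1 expr1n.
  by rewrite !red.
have -> : chr j (C * f.[x] ^+ l) = chr j (c * a * b).
  rewrite -(dlogK C0) -(dlogK c0) -(dlogK (A0 aA)) -(dlogK (B0 bB)) -!exprD chr_expr.
  rewrite (modE _ _ (class_eq aA bB)) chrM chr_expr -(dlogK fx) -exprM chr_expr.
  rewrite [X in _ * X](_ : _ = 1) ?mulr1 //.
  rewrite (modE _ 0%N) ?muln0 ?expr0 //.
  by apply/eqP; rewrite mod0n -/(dvdn _ _) dvdn_mull // nE dvdn_gcdl.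
rewrite -!chrM -[RHS](chr1 j); congr chr; field.
by rewrite c0 (A0 aA) (B0 bB).
Qed.

(** By orthogonality, the sum of all [t j] is [N] times the number of solutions with [h.[x] != 0].
    Without solutions the main terms, each at least [m^2 q / 2], are balanced by errors totalling at
    most [(D + 1) sqrt(q) N m], which forces [m <= 2 (D + 1) sqrt(q)]. *)
Lemma product_hits m : #|A| = m -> #|B| = m ->
  (2 * D <= #|F|)%N -> ((2 * D.+1) ^ 2 * #|F| < m ^ 2)%N ->
  exists a b x, [/\ a \in A, b \in B & c * a * b = h.[x]].
Proof.
move=> Am Bm Dq mq.
case: (boolP [exists a in A, [exists b in B, [exists x, c * a * b == h.[x]]]]).
  case/existsP => a /andP[aA /existsP[b /andP[bB /existsP[x /eqP E]]]].
  by exists a, b, x.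
move/negP => nohit; exfalso.
have h0 : h != 0 by rewrite -size_poly_gt0 size_h.
pose U := inv_sum A; pose V := inv_sum B.
pose t j := chr j c^-1 * U j * V j * T j.
have tE j : t j = \sum_(a in A) \sum_(b in B) \sum_x chr j (c^-1 * a^-1 * b^-1 * h.[x]).
  rewrite /t triple_sum; apply: eq_bigr => a _; apply: eq_bigr => b _.
  by apply: eq_bigr => x _; rewrite !chrM.
have t_sum : \sum_(j < N) t j = 0.
  under eq_bigr => j _ do rewrite tE.
  rewrite exchange_big big1 // => a aA; rewrite exchange_big big1 // => b bB.
  rewrite exchange_big big1 // => x _.
  have [hx0|hx0] := eqVneq h.[x] 0.
    by rewrite big1 // => j _; rewrite hx0 mulr0 chr0.
  rewrite sum_chr ?mulf_neq0 ?invr_neq0 ?(A0 aA) ?(B0 bB) //;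
case: eqP => // E.
  case: nohit; apply/existsP; exists a; rewrite aA /=.
  apply/existsP; exists b; rewrite bB /=; apply/existsP; exists x.
  by apply/eqP; rewrite -[LHS]mulr1 -E; field; rewrite ?c0 ?(A0 aA) ?(B0 bB).
pose Z := #|[pred x | h.[x] != 0]|.
have t_main j : (N %| j * n)%N -> t j = (m ^ 2 * Z)%:R.
  move=> jn; rewrite tE.
  transitivity (\sum_(a in A) \sum_(b in B) (Z%:R : algC)); last first.
    by rewrite !sumr_const Am Bm -!mulrnA; congr (_%:R); ring.
  apply: eq_bigr => a aA; apply: eq_bigr => b bB.
  rewrite (bigID [pred x | h.[x] != 0]) /= [X in _ + X]big1 ?addr0 => [|x]; last first.
    by rewrite negbK => /eqP ->; rewrite mulr0 chr0.
  rewrite -sumr_const; apply: eq_bigr => x hx.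
  by rewrite !chrM chr_value.
have Zq : (#|F| <= 2 * Z)%N.
  have kD : (#|[pred x | h.[x] == 0%R]| <= D)%N.
    rewrite cardE -ltnS -size_h; apply: max_poly_roots => //; last exact: enum_uniq.
    by apply/allP => x; rewrite mem_enum inE.
  have kZ : (#|[pred x | h.[x] == 0%R]| + Z = #|F|)%N.
    by rewrite -(cardC [pred x | h.[x] == 0]); congr (_ + _)%N; apply: eq_card.
  rewrite -(leq_add2l (2 * #|[pred x | h.[x] == 0%R]|)) -mulnDr kZ.
  by rewrite [(2 * #|F|)%N]mul2n -addnn leq_add2r (leq_trans _ Dq) // leq_mul2l kD.
(* The inequality [2 u v <= u^2 + v^2] followed by Parseval for each factor. *)
have UV : \sum_(j < N) `|U j| * `|V j| <= (N * m)%:R.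
  apply: le_trans (_ : \sum_(j < N) (`|U j| ^+ 2 + `|V j| ^+ 2) / 2%:R <= _).
    apply: ler_sum => j _; rewrite ler_pdivlMr ?ltr0n // -subr_ge0.
    have -> : `|U j| ^+ 2 + `|V j| ^+ 2 - `|U j| * `|V j| * 2%:R = (`|U j| - `|V j|) ^+ 2 by ring.
    by rewrite real_exprn_even_ge0 // rpredB // normr_real.
  rewrite -mulr_suml big_split /= !parseval // Am Bm -mulr2n -[X in X / _]mulr_natr.
  by rewrite mulfK // pnatr_eq0.
have key : (m ^ 2 * Z)%:R <= D.+1%:R * sqrtC #|F|%:R * (N * m)%:R :> algC.
  have N0 := prim_order_gt0 eps_prim.
  have split0 : \sum_(j < N | (N %| j * n)%N) t j = - \sum_(j < N | ~~ (N %| j * n)%N) t j.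
    apply/eqP; rewrite -addr_eq0; apply/eqP; rewrite -[RHS]t_sum.
    by rewrite [RHS](bigID (fun j : 'I_N => (N %| j * n)%N)).
  apply: le_trans (_ : `|\sum_(j < N | (N %| j * n)%N) t j| <= _).
    rewrite (eq_bigr (fun=> (m ^ 2 * Z)%:R)) => [|j jn]; last exact: t_main.
    (* All main terms are equal and nonnegative, so the trivial character [j = 0] alone gives the
       lower bound. *)
    rewrite ger0_norm ?sumr_ge0 // (bigD1 (Ordinal N0)) //= ?mul0n ?dvdn0 //.
    by rewrite lerDl sumr_ge0.
  rewrite split0 normrN; apply: le_trans (ler_norm_sum _ _ _) _.
  apply: le_trans (_ : \sum_(j < N | ~~ (N %| j * n)%N) D.+1%:R * sqrtC #|F|%:R * (`|U j| * `|V j|) <= _).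
    apply: ler_sum => j jn; rewrite !normrM norm_chr ?invr_neq0 // mul1r mulrC.
    by rewrite ler_wpM2r ?mulr_ge0 // sum_value_bound.
  rewrite -mulr_sumr ler_wpM2l ?mulr_ge0 ?sqrtC_ge0 ?ler0n //.
  apply: le_trans UV; rewrite [leRHS](bigID (fun j : 'I_N => ~~ (N %| j * n)%N)) /=.
  by rewrite lerDl sumr_ge0 // => j _; rewrite mulr_ge0.
have m0 : (0 < m)%N by rewrite lt0n; apply: contraTneq mq => ->; rewrite -leqNgt.
have q0 : 0 < #|F|%:R :> algC by rewrite ltr0n ltnW // finNzRing_gt1.
have key2 : m%:R <= (2 * D.+1)%:R * sqrtC #|F|%:R :> algC.
  rewrite -(ler_pM2r q0) -(@ler_pM2r _ m%:R) ?ltr0n //.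
  apply: le_trans (_ : (2 * (m ^ 2 * Z))%:R <= _).
    rewrite -!natrM ler_nat (_ : 2 * (m ^ 2 * Z) = m * (2 * Z) * m)%N; last by ring.
    by rewrite leq_mul2r leq_mul2l Zq !orbT.
  rewrite natrM [(2 * D.+1)%:R]natrM -!mulrA ler_wpM2l ?ler0n // mulrA.
  apply: le_trans key _; rewrite ler_wpM2l ?mulr_ge0 ?sqrtC_ge0 ?ler0n //.
  by rewrite -natrM ler_nat leq_mul2r leq_pred orbT.
have : (m ^ 2)%:R <= ((2 * D.+1) ^ 2 * #|F|)%:R :> algC.
  rewrite natrM !natrX -[X in _ * X]sqrtCK -exprMn ler_pXn2r // qualifE /= ?ler0n //.
  by rewrite mulr_ge0 ?sqrtC_ge0 ?ler0n.
by rewrite ler_nat leqNgt mq.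
Qed.

End Hits.
End Characters.

(** * Residue classes of units *)


(** Greedy choice: the elements already picked never exhaust the next set. *)
Lemma distinct_choice (T : finType) k (S : 'I_k -> {set T}) :
  (forall i, k <= #|S i|)%N -> exists2 w : 'I_k -> T, injective w & forall i, w i \in S i.
Proof.
elim: k S => [|k IH] S Sk.
  have nil_ord (i : 'I_0) : T by case: i.
  by exists nil_ord => -[].
have [i|w winj wS] := IH (fun i => S (lift ord0 i)); first exact: ltnW.
pose W := [set w i | i in 'I_k].
have [x xS xW] : exists2 x, x \in S ord0 & x \notin W.
  apply/subsetPn; apply: contraTN (Sk ord0) => /subset_leq_card SW.
  by rewrite -ltnNge ltnS (leq_trans SW) // (leq_trans (leq_imset_card _ _)) ?card_ord.
exists (fun i => if unlift ord0 i is Some j then w j else x).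
  move=> i j; case: unliftP => [i'|] ->; case: unliftP => [j'|] -> //.
  - by move=> /winj ->.
  - by move=> wx; case/negP: xW; rewrite -wx imset_f.
  - by move=> wx; case/negP: xW; rewrite wx imset_f.
by move=> i; case: unliftP => [i'|] ->.
Qed.

Lemma subset_of_card (T : finType) (S : {set T}) m :
  (m <= #|S|)%N -> exists2 A : {set T}, A \subset S & #|A| = m.
Proof.
elim: m => [|m IH] mS; first by exists set0; rewrite ?sub0set ?cards0.
have [A AS Am] := IH (ltnW mS).
have [x xS xA] : exists2 x, x \in S & x \notin A.
  by apply/subsetPn; apply: contraTN mS => /subset_leq_card; rewrite Am -leqNgt.
by exists (x |: A); rewrite ?subUset ?sub1set ?xS // cardsU1 xA Am.
Qed.

Section Classes.

Variables (F : finFieldType) (g : {unit F}) (n : nat).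
Hypotheses (g_gen : <[g]>%g = [set: {unit F}]) (n0 : (0 < n)%N) (nN : (n %| #|F|.-1)%N).
Let N := #|F|.-1.
Let z : F := val g.

Lemma card_units : #|[set: {unit F}]| = N.
Proof. exact: card_finField_unit. Qed.

Lemma generator_prim : N.-primitive_root z.
Proof.
have og : #[g]%g = N by rewrite /order g_gen card_units.
have zX m : z ^+ m = val (g ^+ m)%g by rewrite FinRing.val_unitX.
have N0 : (0 < N)%N by rewrite -og order_gt0.
have [|m mz mN] := prim_order_exists N0 (z := z).
  by rewrite zX -og expg_order.
suff -> : N = m by [].
apply/eqP; rewrite eqn_dvd mN andbT -og order_dvdn; apply/eqP/val_inj.
by rewrite -zX (prim_expr_order mz).
Qed.

Let zp := generator_prim.

(** The quotient map from the units modulo [n]-th powers, in the coordinate sending [g] to 1. *)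
Definition unit_class (u : {unit F}) : Zmod n := inZp (dlog z (val u)).

Lemma n_succ : n.-1.+1 = n. Proof. exact: prednK. Qed.

Lemma val_unit_neq0 (u : {unit F}) : val u != 0.
Proof. by rewrite -unitfE; exact: (valP u). Qed.

Lemma inZp_eq i j : (i = j %[mod n]) <-> (inZp i = inZp j :> Zmod n).
Proof.
split=> [E|/(congr1 val) /=]; last by rewrite n_succ.
by apply: val_inj; rewrite /= n_succ.
Qed.

Lemma inZpD i j : inZp (i + j) = inZp i + inZp j :> Zmod n.
Proof. by apply: val_inj; rewrite /= modnDm. Qed.

Lemma modN_mod_n i j : i = j %[mod N] -> i = j %[mod n].
Proof. by move=> E; rewrite -(modn_dvdm i nN) -(modn_dvdm j nN) -/N E. Qed.

Lemma unit_classM u v : unit_class (u * v)%g = unit_class u + unit_class v.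
Proof.
rewrite -inZpD; apply/inZp_eq/modN_mod_n; rewrite FinRing.val_unitM.
by apply: (dlogM zp); apply: val_unit_neq0.
Qed.

Lemma unit_class_prod (I : finType) (P : pred I) (a : I -> {unit F}) :
  unit_class (\prod_(i | P i) a i)%g = \sum_(i | P i) unit_class (a i).
Proof.
elim/big_rec2: _ => [|i y1 y2 _ <-]; last exact: unit_classM.
by have := unit_classM 1 1; rewrite mulg1 -{1}[unit_class 1]addr0 => /addrI.
Qed.

Lemma unit_class_genX i : unit_class (g ^+ i)%g = inZp i.
Proof.
apply/inZp_eq/modN_mod_n; rewrite FinRing.val_unitX; exact: (dlog_expr zp).
Qed.

Lemma card_class i : (#|[set u | unit_class u == i]| * n = N)%N.
Proof.
have fib j : #|[set u | unit_class u == j]| = #|[set u | unit_class u == 0]|.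
  pose v := (g ^+ (val j))%g; have vj : unit_class v = j.
    by rewrite unit_class_genX; apply: val_inj; rewrite /= modn_small.
  rewrite -(card_imset (mem [set u | unit_class u == 0]) (mulgI v)).
  apply: eq_card => u; rewrite inE; apply/idP/imsetP => [/eqP uj|[w]].
    exists (v^-1 * u)%g; rewrite ?mulKVg // inE.
    by rewrite -(inj_eq (addrI (unit_class v))) -unit_classM mulKVg addr0 vj uj.
  by rewrite inE => /eqP w0 ->; rewrite unit_classM w0 addr0 vj.
have part : #|[set: {unit F}]| = (\sum_(j : Zmod n) #|[set u | unit_class u == j]|)%N.
  rewrite -sum1_card (partition_big unit_class xpredT) //=; apply: eq_bigr => j _.
  by rewrite -sum1_card; apply: eq_bigl => u; rewrite !inE.
rewrite -card_units part (eq_bigr _ (fun j _ => fib j)) sum_nat_const card_ord fib mulnC.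
by congr (_ * _)%N; apply/esym/n_succ.
Qed.

Section Count.

Variables (k D l s : nat) (h f : {poly F}) (C : {unit F}).
Hypotheses (k2 : (1 < k)%N) (size_h : size h = D.+1) (D0 : (0 < D)%N) (l0 : (0 < l)%N).
Hypotheses (hE : h = val C *: f ^+ l) (nE : n = gcdn l N).
Hypothesis f_pf : forall r b, (1 < r)%N -> ~~ (f %= b ^+ r).
Hypothesis clC : unit_class C = inZp s.

(** A nonzero value is [C] times an [l]-th power, and [n] divides [l]. *)
Lemma unit_class_value (x : F) (u : {unit F}) : val u = h.[x] -> unit_class u = inZp s.
Proof.
move=> uh; have : h.[x] != 0 by rewrite -uh val_unit_neq0.
rewrite hE hornerZ horner_exp mulf_eq0 negb_or expf_eq0 l0 /= => /andP[_ fx].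
have fxU : f.[x] \is a GRing.unit by rewrite unitfE.
have -> : u = (C * FinRing.unit F fxU ^+ l)%g.
  apply: val_inj; rewrite FinRing.val_unitM FinRing.val_unitX /= uh hE.
  by rewrite hornerZ horner_exp.
have clX (v : {unit F}) i : unit_class (v ^+ i)%g = unit_class v *+ i.
  elim: i => [|i IH]; last by rewrite expgS unit_classM IH mulrS.
  by have := unit_classM 1 1; rewrite mulg1 -{1}[unit_class 1]addr0 expg0 mulr0n => /addrI.
rewrite unit_classM clX clC.
have -> : unit_class (FinRing.unit F fxU) *+ l = 0; last by rewrite addr0.
apply: val_inj; rewrite Zp_mulrn /= n_succ; apply/eqP.
by rewrite -/(dvdn _ _) dvdn_mull // nE dvdn_gcdl.
Qed.

(** Take the union of the classes indexed by an optimal [B]: the class of a product of [k] members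
    lies in [kB]. Multiplying by [n] keeps the inequality in the naturals. *)
Lemma max_avoiding_lower :
  (max_sumset_missing k (inZp s : Zmod n) * N <= max_avoiding k h * n)%N.
Proof.
have N0 : (0 < N)%N by rewrite -card_units -g_gen order_gt0.
rewrite -leq_divRL //; apply/bigmax_leqP => B sB; rewrite leq_divRL //.
pose A := [set u | unit_class u \in B].
have An : (#|A| * n = #|B| * N)%N.
  rewrite -sum1_card (partition_big unit_class (mem B)) /=; last by move=> u; rewrite inE.
  rewrite big_distrl /= -sum_nat_const; apply: eq_bigr => i iB.
  rewrite -(card_class i) -sum1_card; congr (_ * _)%N; apply: eq_bigl => u.
  by rewrite !inE; case: eqP => [->|]; rewrite ?iB ?andbF.
rewrite -An leq_mul2r; apply/orP; right; apply: leq_bigmax_cond.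
apply/forallP => a; apply/forallP => x; apply/implyP => /andP[/ffun_onP aA _].
apply: contra sB => /eqP ax; apply/imsetP; exists [ffun i => unit_class (a i)].
  by apply/ffun_onP => i; rewrite ffunE; have := aA i; rewrite inE.
under eq_bigr => i _ do rewrite ffunE.
rewrite -unit_class_prod; apply/esym/(@unit_class_value x); rewrite -ax.
by elim/big_rec2: _ => [|i y1 y2 _ <-] //; rewrite FinRing.val_unitM.
Qed.

(** The classes that [A] meets in at least [2 M + k] elements cannot have [s] in their [k]-fold
    sumset, by [product_hits]; each other class holds fewer than [2 M + k] elements of [A]. *)
Lemma max_avoiding_upper M : (2 * D <= #|F|)%N -> ((2 * D.+1) ^ 2 * #|F| < M ^ 2)%N ->
  (max_avoiding k h * n
    <= max_sumset_missing k (inZp s : Zmod n) * N + n * (n * (2 * M + k)))%N.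
Proof.
move=> Dq Mq; rewrite -leq_divRL //; apply/bigmax_leqP => A Aav; rewrite leq_divRL //.
pose Ai i := [set u in A | unit_class u == i].
(* The threshold leaves room for two disjoint sets of size [M] and for the other [k - 2] factors,
   even if all classes coincide. *)
pose B := [set i | 2 * M + k <= #|Ai i|]%N.
have sB : inZp s \notin ksumset k B.
  apply/negP => /imsetP[b /ffun_onP bB sb].
  case: k k2 Aav @B b bB sb => [|[|k']] // _ Aav B b bB sb.
  have bA i : (2 * M + k'.+2 <= #|Ai (b i)|)%N by have := bB i; rewrite inE.
  pose i0 : 'I_k'.+2 := ord0; pose i1 : 'I_k'.+2 := lift ord0 ord0.
  have [|A1 A1S A1M] := @subset_of_card _ (Ai (b i0)) M; first by have := bA i0; lia.
  have [|A2 A2S A2M] := @subset_of_card _ (Ai (b i1) :\: A1) M.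
    rewrite cardsD -A1M; apply: leq_trans (leq_sub2l _ (subset_leq_card (subsetIr _ _))).
    by rewrite leq_subRL ?A1M; have := bA i1; lia.
  (* The fixed factors avoid both [A1] and [A2], so the final [k] factors are distinct whichever
     pair is found. *)
  have [i|w winj wS] := @distinct_choice _ k' (fun i => Ai (b (lift ord0 (lift ord0 i))) :\: (A1 :|: A2)).
    rewrite cardsD; apply: leq_trans (leq_sub2l _ (subset_leq_card (subsetIr _ _))).
    have := bA (lift ord0 (lift ord0 i)); have := leq_card_setU A1 A2; rewrite A1M A2M => h1 h2.
    by have := h1.1; lia.
  have [eps eps_prim] : exists eps : algC, N.-primitive_root eps.
    by have [e ep] := C_prim_root_exists (prim_order_gt0 zp); exists e.
  pose c := (\prod_i w i)%g.
  have clw : unit_class c = \sum_i b (lift ord0 (lift ord0 i)).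
    rewrite unit_class_prod; apply: eq_bigr => i _; have := wS i.
    by rewrite !inE => /and3P[_ _ /eqP].
  have nz (U : {set {unit F}}) y : y \in [set val u | u in U] -> y != 0.
    by move=> /imsetP[u _ ->]; apply: val_unit_neq0.
  have class_eq y y' : y \in [set val u | u in A1] -> y' \in [set val u | u in A2] ->
      dlog z (val c) + dlog z y + dlog z y' = dlog z (val C) %[mod n].
    move=> /imsetP[u uA1 ->] /imsetP[u' uA2 ->]; apply/inZp_eq.
    rewrite !inZpD -/(unit_class _) -/(unit_class c) -/(unit_class u) -/(unit_class u') clw -[RHS]/(unit_class C) clC sb.
    have := subsetP A1S u uA1; rewrite inE => /andP[_ /eqP ->].
    have := subsetP A2S u' uA2; rewrite !inE => /and3P[_ _ /eqP ->].
    by rewrite !big_ord_recl /= addrC addrA addrC addrA addrAC addrC addrA.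
  have cardM (U : {set {unit F}}) : #|U| = M -> #|[set val u | u in U]| = M.
    by move=> UM; rewrite card_imset //; apply: val_inj.
  have [_ [_ [x [/imsetP[u uA1 ->] /imsetP[u' uA2 ->] cx]]]] :=
    product_hits zp eps_prim size_h D0 l0 hE (val_unit_neq0 C) (val_unit_neq0 c)
      f_pf nE (@nz A1) (@nz A2) class_eq (cardM _ A1M) (cardM _ A2M) Dq Mq.
  pose a : {ffun 'I_k'.+2 -> {unit F}} := [ffun i : 'I_k'.+2 => if unlift ord0 i is Some j then
    (if unlift ord0 j is Some t then w t else u') else u].
  have a0 : a ord0 = u by rewrite ffunE unlift_none.
  have a1 : a (lift ord0 ord0) = u' by rewrite ffunE liftK unlift_none.
  have a2 t : a (lift ord0 (lift ord0 t)) = w t by rewrite ffunE !liftK.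
  have wN t : (w t \notin A1) && (w t \notin A2).
    by have := wS t; rewrite !inE negb_or => /andP[].
  have u'N : u' \notin A1 by have := subsetP A2S u' uA2; rewrite inE => /andP[].
  have a_inj : injective a.
    move=> i j; case: (unliftP ord0 i) => [i'|] ->; case: (unliftP ord0 j) => [j'|] ->;
      rewrite ?a0 //.
    - case: (unliftP ord0 i') => [i''|] ->; case: (unliftP ord0 j') => [j''|] ->;
        rewrite ?a1 ?a2 //; first by move=> /winj ->.
      + by move=> wu; have := wN i''; rewrite wu uA2 andbF.
      + by move=> wu; have := wN j''; rewrite -wu uA2 andbF.
    - case: (unliftP ord0 i') => [i''|] ->; rewrite ?a1 ?a2 => wu.
        by have := wN i''; rewrite wu uA1.
      by move: u'N; rewrite wu uA1.
    - case: (unliftP ord0 j') => [j''|] ->; rewrite ?a1 ?a2 => wu.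
        by have := wN j''; rewrite -wu uA1.
      by move: u'N; rewrite -wu uA1.
  have aA : a \in ffun_on (mem A).
    apply/ffun_onP => i; case: (unliftP ord0 i) => [i'|] ->; rewrite ?a0.
      case: (unliftP ord0 i') => [i''|] ->; rewrite ?a1 ?a2.
        by have := wS i''; rewrite !inE => /and3P[].
      by have := subsetP A2S u' uA2; rewrite !inE => /and3P[].
    by have := subsetP A1S u uA1; rewrite !inE => /andP[].
  move/forallP/(_ a)/forallP/(_ x): Aav; rewrite aA /=.
  have -> : injectiveb a by apply/injectiveP.
  rewrite -cx !big_ord_recl a0 a1 /= => /negP; apply; apply/eqP.
  rewrite (eq_bigr (fun t => val (w t))) => [|t _]; last by rewrite a2.
  have -> : val c = \prod_t val (w t).
    by rewrite /c; elim/big_rec2: _ => [|i y1 y2 _ <-] //; rewrite FinRing.val_unitM.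
  by rewrite mulrA mulrC mulrA.
have Asum : (#|A| = \sum_i #|Ai i|)%N.
  rewrite -sum1_card (partition_big unit_class xpredT) //=; apply: eq_bigr => j _.
  by rewrite -sum1_card; apply: eq_bigl => u; rewrite !inE.
rewrite Asum big_distrl /= (bigID (mem B)) /=; apply: leq_add.
  apply: leq_trans (_ : #|B| * N <= _)%N; last first.
    by rewrite leq_mul2r; apply/orP; right; apply: leq_bigmax_cond.
  rewrite -sum_nat_const; apply: leq_sum => i _.
  rewrite -(card_class i) leq_mul2r; apply/orP; right; apply: subset_leq_card.
  by apply/subsetP => u; rewrite !inE => /andP[].
apply: leq_trans (_ : \sum_(i : Zmod n) n * (2 * M + k) <= _)%N.
  rewrite big_mkcond /=; apply: leq_sum => i _; case: ifP => // iB.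
  by rewrite mulnC leq_mul2l; apply/orP; right; move: iB; rewrite inE -ltnNge => /ltnW.
by rewrite sum_nat_const card_ord leq_mul2r n_succ leqnn orbT.
Qed.

End Count.

End Classes.


(** If [f] were [c b^r], then [h] would be a constant times [b^(r l)], and [r l > l]. *)
Lemma largest_power_free (F : finFieldType) (h f : {poly F}) l (C : {unit F}) :
  h != 0 -> largest_power h l -> h = val C *: f ^+ l ->
  forall r b, (1 < r)%N -> ~~ (f %= b ^+ r).
Proof.
move=> h0 [l0 _ lmax] hE r b r1; apply/negP => /eqpf_eq[c c0 fE].
have cU : val C * c ^+ l \is a GRing.unit.
  by rewrite unitfE mulf_neq0 ?val_unit_neq0 ?expf_neq0.
have := lmax (r * l)%N; rewrite muln_gt0 l0 (ltnW r1) => /(_ isT) H.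
have : (r * l <= l)%N.
  by apply: H; exists (FinRing.unit F cU), b; rewrite hE fE exprZn scalerA exprM.
by rewrite -[X in (_ <= X)%N]mul1n leq_pmul2r // leqNgt r1.
Qed.

(** An element [g^i] of [H] satisfies [g^(i |H|) = 1], so [n |H|] divides [i |H|] and [n] divides
    [i]. *)
Lemma coset_class (F : finFieldType) (g C : {unit F}) (H : {group {unit F}}) n s :
  <[g]>%g = [set: {unit F}] -> #|[set: {unit F}] : H|%g = n ->
  C \in ((g ^+ s)%g *: H)%g -> unit_class g n C = inZp s.
Proof.
move=> gg Hn /lcosetP[w wH ->].
have Lag := Lagrange (subsetT H); rewrite /= Hn card_units in Lag.
have N0 : (0 < #|F|.-1)%N by rewrite -card_units -gg order_gt0.
have n0 : (0 < n)%N by move: N0; rewrite -Lag muln_gt0 => /andP[].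
have nN : (n %| #|F|.-1)%N by rewrite -Lag dvdn_mull.
have /cycleP[i wi] : w \in <[g]>%g by rewrite gg inE.
rewrite (unit_classM gg n0 nN) wi !(unit_class_genX gg n0 nN).
suff -> : inZp i = 0 :> Zmod n by rewrite addr0.
apply: val_inj; rewrite /= prednK //; apply/eqP.
rewrite -/(dvdn _ _) -(dvdn_pmul2l (cardG_gt0 H)) Lag -card_units -gg mulnC.
by rewrite -/(order g) order_dvdn expgM -wi expg_cardG.
Qed.

Theorem theorem1p3 (R : realType) (k D : nat) (hk : (2 <= k)%N)
    (hD : (1 <= D)%N) :
  exists K : R,
  forall (F : finFieldType) (h : {poly F}) (l n s : nat) (C : {unit F})
    (f : {poly F}) (H : {group {unit F}}) (g : {unit F}),
  size h = D.+1 ->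
  largest_power h l ->
  h = (val C : F) *: f ^+ l ->
  n = gcdn l (#|F| - 1) ->
  #|[set: {unit F}] : H|%g = n ->
  <[g]>%g = [set: {unit F}] ->
  (s < n)%N ->
  C \in ((g ^+ s)%g *: H)%g ->
  `|(max_avoiding k h)%:R
    - (max_sumset_missing k (inZp s : Zmod n))%:R / n%:R * #|F|%:R|
    <= K * Num.sqrt #|F|%:R.
Proof.
(* The first summand bounds [n (2 (M + 1) + k)] using [n <= D] and [M <= 2 (D + 1) sqrt(q)]; the
   second takes care of [q < 2 D]. *)
exists (D * (4 * D + 6 + k) + 2 * D)%:R.
move=> F h l n s C f H g size_h lp hE nE Hn gg sn CH.
have h0 : h != 0 by rewrite -size_poly_gt0 size_h.
have l0 : (0 < l)%N by case: lp.
have n0 : (0 < n)%N by apply: leq_ltn_trans sn.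
have f_pf := largest_power_free h0 lp hE.
rewrite subn1 in nE.
have nN : (n %| #|F|.-1)%N by rewrite nE dvdn_gcdr.
have clC := coset_class gg Hn CH.
have q1 : (1 < #|F|)%N := finNzRing_gt1 F.
have nD : (n <= D)%N.
  apply: (@leq_trans l); first by rewrite dvdn_leq // nE dvdn_gcdl.
  have sf : ((size f).-1 * l)%N = D.
    by rewrite -size_exp -(size_scale _ (val_unit_neq0 C)) -hE size_h.
  by rewrite -sf leq_pmull //; move: hD; rewrite -sf muln_gt0 => /andP[].
set m := max_sumset_missing _ _; set A := max_avoiding _ _.
have lower : (m * #|F|.-1 <= A * n)%N := max_avoiding_lower gg n0 nN k l0 hE nE clC.
have mn : (m <= n)%N.
  apply/bigmax_leqP => B _; apply: leq_trans (max_card _) _.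
  by rewrite card_ord prednK.
have AN : (A <= #|F|.-1)%N.
  apply/bigmax_leqP => B _; rewrite -card_units; exact: subset_leq_card (subsetT B).
set q := #|F| in q1 lower AN *; set r : R := Num.sqrt q%:R.
have r2 : r ^+ 2 = q%:R by rewrite sqr_sqrtr.
have q0R : 1 <= q%:R :> R by rewrite ler1n ltnW.
have r1 : 1 <= r by rewrite -[X in X <= _]sqrtr1; apply: ler_wsqrtr.
have r0 : 0 <= r by apply: le_trans r1.
have nR : 0 < n%:R :> R by rewrite ltr0n.
have mnR : m%:R / n%:R <= 1 :> R by rewrite ler_pdivrMr // mul1r ler_nat.
have mn0 : 0 <= m%:R / n%:R :> R by rewrite divr_ge0.
have K1 : 1 <= (D * (4 * D + 6 + k) + 2 * D)%:R :> R by rewrite ler1n (leq_trans _ (leq_addl _ _)) // muln_gt0 hD.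
(* For [q < 2 D] both quantities lie between 0 and [q = sqrt(q)^2], and [sqrt(q) <= q <= 2 D]. *)
have [Dq|qD] := leqP (2 * D) q; last first.
  apply: le_trans (_ : r ^+ 2 <= _).
    have Aq : A%:R <= r ^+ 2 by rewrite r2 ler_nat (leq_trans AN) // leq_pred.
    have mq : m%:R / n%:R * r ^+ 2 <= r ^+ 2 by rewrite ler_piMl // exprn_ge0.
    have mq0 : 0 <= m%:R / n%:R * r ^+ 2 by rewrite mulr_ge0 // exprn_ge0.
    by rewrite -r2 ler_norml; have := ler0n R A; lra.
  rewrite expr2 ler_wpM2r //; apply: le_trans (_ : (2 * D)%:R <= _); last first.
    by rewrite ler_nat leq_addl.
  apply: le_trans (_ : r ^+ 2 <= _); first by rewrite expr2 ler_peMl.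
  by rewrite r2 ler_nat ltnW.
(* [M + 1] is the least integer admissible in [max_avoiding_upper], so [M] itself is at most
   [2 (D + 1) sqrt(q)]. *)
have [M XM Mmin] : exists2 M, ((2 * D.+1) ^ 2 * q < M.+1 ^ 2)%N & (M ^ 2 <= (2 * D.+1) ^ 2 * q)%N.
  have ex : exists M, ((2 * D.+1) ^ 2 * q < M ^ 2)%N.
    by exists ((2 * D.+1) ^ 2 * q).+1; rewrite expnS expn1 mulSn ltnS leq_addr.
  case: (ex_minnP ex) => -[|M] // XM Mmin; exists M => //.
  by rewrite leqNgt; apply/negP => /Mmin; rewrite ltnn.
have upper := max_avoiding_upper gg n0 nN hk size_h hD l0 hE nE f_pf clC Dq XM.
rewrite -/m -/A in upper.
have Mr : M%:R <= (2 * D.+1)%:R * r.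
  rewrite -(@ler_pXn2r _ 2) ?nnegrE ?mulr_ge0 ?ler0n // exprMn r2 -!natrX -natrM ler_nat //.
have qE : q%:R = q.-1%:R + 1 :> R by rewrite natr1 prednK // ltnW.
(* Passing from [q - 1] to [q] costs [m / n], which is at most 1. *)
have lowerR : m%:R / n%:R * q%:R - A%:R <= 1 :> R.
  rewrite qE mulrDr mulr1.
  have : m%:R / n%:R * q.-1%:R <= A%:R :> R.
    by rewrite mulrAC ler_pdivrMr // -!natrM ler_nat.
  lra.
have upperR : A%:R - m%:R / n%:R * q%:R <= (n * (2 * M.+1 + k))%:R :> R.
  have : A%:R <= m%:R / n%:R * q.-1%:R + (n * (2 * M.+1 + k))%:R :> R.
    rewrite -(ler_pM2r nR) mulrDl mulrAC divfK ?gt_eqF // -!natrM -natrD ler_nat.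
    by rewrite [X in (_ <= _ + X)%N]mulnC.
  by rewrite qE mulrDr mulr1; lra.
have bound : (n * (2 * M.+1 + k))%:R <= (D * (4 * D + 6 + k))%:R * r.
  apply: le_trans (_ : D%:R * ((4 * D + 6 + k)%:R * r) <= _); last by rewrite natrM mulrA.
  rewrite natrM ler_pM ?ler0n ?ler_nat //.
  have kr : k%:R <= k%:R * r by rewrite ler_peMr.
  have := Mr; rewrite !natrD !natrM -!natr1 => Mr'.
  by move: kr Mr' r1; move: (k%:R : R) (M%:R : R) (D%:R : R) => k_ M_ D_; lra.
have Kr : (D * (4 * D + 6 + k))%:R * r <= (D * (4 * D + 6 + k) + 2 * D)%:R * r.
  by rewrite ler_wpM2r // ler_nat leq_addr.
have K1r : 1 <= (D * (4 * D + 6 + k) + 2 * D)%:R * r by rewrite mulr_ege1.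
rewrite ler_norml; apply/andP; split; last first.
  by apply: le_trans upperR (le_trans bound Kr).
by rewrite lerNl opprB; apply: le_trans lowerR K1r.
Qed.
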